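(* Let $M,N\in\mathbb{N}$ with $M<N$. Let $0=a_0<a_1<\dots<a_{M-1}$ be integers with $a_{M-1}\le N-1$, and let $\mathcal{I}_M=\bigcup_{k=0}^{M-1}[a_k,a_k+1)\subset[0,N)$. Then $$\mathcal{B}_M=\bigcup_{j=1}^{M}\left\{e^{2\pi i\left(n+\frac{j-1}{N}\right)x}\right\}_{n\in\mathbb{Z}}$$ is a (Riesz) basis for $L^2(\mathcal{I}_M)$.
   Context: $\mathbb{N}=\{1,2,3,\dots\}$. A sequence $\{v_j\}$ in a separable Hilbert space $H$ is a Riesz basis if there are constants $A,B>0$ such that for every finite family of complex scalars $\{c_j\}_{j\in J}$ one has $A\sum_{j\in J}|c_j|^2\le\|\sum_{j\in J}c_jv_j\|^2\le B\sum_{j\in J}|c_j|^2$, and for every $w\in H$ one has $A\|w\|^2\le\sum_j|\langle w,v_j\rangle|^2\le B\|w\|^2$. Exponentials are regarded as elements of $L^2(\mathcal{I}_M)$ by restriction. ''Basis'' for a system of exponentials means Riesz basis. *)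

(* Defs.v *)
From HB Require Import structures.
From mathcomp Require Import all_boot all_order all_algebra finmap.
From mathcomp Require Import generic_quotient ring_quotient.
From mathcomp Require Import all_classical all_reals all_analysis.
From mathcomp Require Import measurable_realfun complex.
From mathcomp Require Import ring lra.
Import Order.TTheory GRing.Theory Num.Theory.
Import numFieldNormedType.Exports.

Set Implicit Arguments.
Unset Strict Implicit.
Unset Printing Implicit Defensive.

Local Open Scope classical_set_scope.
Local Open Scope ring_scope.
Local Open Scope quotient_scope.
Local Open Scope complex_scope.

Local Notation Re := (@complex.Re _).
Local Notation Im := (@complex.Im _).
Local Notation cabs := (@Normc.normc _).
Local Notation conjC_ R := (@Num.conj R[i]).

(* [Num.conj] on R[i] is complex conjugation; [Normc.normc] is the modulus
   with values in R (the norm `|z| of R[i] takes its values in R[i]). *)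

Section RieszBasis.
Context (R : realType) (V : lmodType R[i]) (ip : {dot V for conjC_ R}).

Definition sqnorm (w : V) : R := Re (ip w w).

Definition riesz_basis (I : countType) (v : I -> V) : Prop :=
  exists A B : R, [/\ 0 < A, 0 < B,
    forall (J : {fset I}) (c : I -> R[i]),
      A * (\sum_(j <- J) cabs (c j) ^+ 2)
        <= sqnorm (\sum_(j <- J) c j *: v j)
        <= B * (\sum_(j <- J) cabs (c j) ^+ 2) &
    forall w : V,
      (A%:E * (sqnorm w)%:E
        <= \esum_(j in [set: I]) (cabs (ip w (v j)) ^+ 2)%:E
        <= B%:E * (sqnorm w)%:E)%E].

End RieszBasis.

Section SquareIntegrable.
Context d (T : measurableType d) (R : realType).
Variable mu : {measure set T -> \bar R}.
Variables (D : set T) (mD : measurable D).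
Implicit Types (f g : T -> R[i]) (u v : T -> R).

Definition sqintegrable f : Prop :=
  [/\ measurable_fun D (Re \o f), measurable_fun D (Im \o f)
    & mu.-integrable D (fun x => (cabs (f x) ^+ 2)%:E)].

Definition sqintR u : Prop :=
  measurable_fun D u /\ mu.-integrable D (fun x => (u x ^+ 2)%:E).

Lemma cabs2 (z : R[i]) : cabs z ^+ 2 = Re z ^+ 2 + Im z ^+ 2.
Proof. by case: z => a b /=; rewrite sqr_sqrtr // addr_ge0 ?sqr_ge0. Qed.

Lemma le_sqint u v : measurable_fun D u -> (forall x, D x -> u x ^+ 2 <= v x) ->
  mu.-integrable D (EFin \o v) -> sqintR u.
Proof.
move=> mu1 uv iv; split => //; apply: (le_integrable mD _ _ iv).
  by apply/measurable_EFinP; exact: measurable_funX.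
move=> x Dx; rewrite /= lee_fin ger0_norm ?sqr_ge0 //.
by apply: le_trans (uv _ Dx) _; exact: ler_norm.
Qed.

Lemma sqintD u v : sqintR u -> sqintR v -> sqintR (fun x => u x + v x).
Proof.
move=> [mu1 iu] [mv iv]; apply: (@le_sqint _ (fun x => 2 * (u x ^+ 2 + v x ^+ 2))).
- exact: measurable_funD.
- move=> x _; rewrite -subr_ge0.
  have -> : 2 * (u x ^+ 2 + v x ^+ 2) - (u x + v x) ^+ 2 = (u x - v x) ^+ 2.
    by rewrite sqrrD sqrrB mulr_natl !mulr2n; ring.
  exact: sqr_ge0.
- have := integrableZl mD 2 (integrableD mD iu iv).
  by apply: eq_integrable => // x _ /=; rewrite -EFinD -EFinM.
Qed.

Lemma sqintZ (r : R) u : sqintR u -> sqintR (fun x => r * u x).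
Proof.
move=> [mu1 iu]; apply: (@le_sqint _ (fun x => r ^+ 2 * u x ^+ 2)).
- exact: measurable_funM.
- by move=> x _; rewrite exprMn.
- have := integrableZl mD (r ^+ 2) iu.
  by apply: eq_integrable => // x _ /=; rewrite -EFinM.
Qed.

Lemma sqintM u v : sqintR u -> sqintR v ->
  mu.-integrable D (fun x => (u x * v x)%:E).
Proof.
move=> [mu1 iu] [mv iv]; apply: (le_integrable mD _ _ (integrableD mD iu iv)).
  by apply/measurable_EFinP; exact: measurable_funM.
move=> x _; rewrite /= lee_fin normrM [leRHS]ger0_norm ?addr_ge0 ?sqr_ge0 //.
rewrite -[u x ^+ 2]real_normK ?num_real // -[v x ^+ 2]real_normK ?num_real //.
have := sqr_ge0 (`|u x| - `|v x|).
have := mulr_ge0 (normr_ge0 (u x)) (normr_ge0 (v x)).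
by move: `|u x| `|v x| => a b h1; rewrite sqrrB mulr2n; lra.
Qed.

Lemma sqintegrableE f :
  sqintegrable f <-> sqintR (fun x => Re (f x)) /\ sqintR (fun x => Im (f x)).
Proof.
split=> [[mr mi fi]|[[mr ir] [mi ii]]].
  by split; apply: (@le_sqint _ (fun x => cabs (f x) ^+ 2)) => // x _;
    rewrite cabs2 ?lerDl ?lerDr sqr_ge0.
split=> //; have := integrableD mD ir ii.
by apply: eq_integrable => // x _; rewrite /= cabs2.
Qed.

(* The predicate carries the (otherwise unused) measurability proof of D so
   that the algebraic instances can be inferred. *)
Definition L2pred of measurable D : {pred T -> R[i]} :=
  [pred f | `[< sqintegrable f >]].

Lemma L2predP f : reflect (sqintegrable f) (f \in L2pred mD).
Proof. exact: asboolP. Qed.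

Lemma L2pred_submod_closed : submod_closed (L2pred mD).
Proof.
have sq0 : sqintR (fun=> 0).
  apply: (@le_sqint _ (cst 0)) => [|x _|]; first exact: measurable_cst.
    by rewrite expr0n.
  exact: integrable0.
split; first by apply/L2predP/sqintegrableE.
move=> a f g /L2predP/sqintegrableE[rf jf] /L2predP/sqintegrableE[rg jg].
apply/L2predP/sqintegrableE; case: a => r s; split.
- have := sqintD (sqintD (sqintZ r rf) (sqintZ (- s) jf)) rg.
  congr sqintR; apply/funext => x /=; rewrite !fctE.
  by case: (f x) (g x) => [? ?] [? ?] /=; ring.
- have := sqintD (sqintD (sqintZ r jf) (sqintZ s rf)) jg.
  congr sqintR; apply/funext => x /=; rewrite !fctE.
  by case: (f x) (g x) => [? ?] [? ?] /=; ring.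
Qed.

HB.instance Definition _ :=
  GRing.isSubmodClosed.Build _ _ (L2pred mD) L2pred_submod_closed.

Record L2fun := MkL2fun { L2fun_val :> T -> R[i]; _ : L2fun_val \in L2pred mD }.

HB.instance Definition _ := [isSub for L2fun_val].
HB.instance Definition _ := [Choice of L2fun by <:].
HB.instance Definition _ := [SubChoice_isSubLmodule of L2fun by <:].

Lemma L2funPE (a : R[i]) (f g : L2fun) x : (a *: f + g) x = a * f x + g x.
Proof. by []. Qed.

Definition L2null : {pred L2fun} :=
  [pred f : L2fun | `[< {ae mu, forall x, D x -> f x = 0} >]].

Lemma L2nullP (f : L2fun) :
  reflect {ae mu, forall x, D x -> f x = 0} (f \in L2null).
Proof. exact: asboolP. Qed.

Lemma L2null_submod_closed : submod_closed L2null.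
Proof.
split; first by apply/L2nullP; apply: aeW.
move=> a f g /L2nullP f0 /L2nullP g0; apply/L2nullP.
by apply: filterS2 f0 g0 => x fx gx Dx; rewrite L2funPE fx // gx // mulr0 addr0.
Qed.

HB.instance Definition _ :=
  GRing.isSubmodClosed.Build _ _ L2null L2null_submod_closed.

(* L^2(D; C): square-integrable complex functions on D modulo functions that
   vanish almost everywhere on D.  The values of a function outside D are
   irrelevant, so an element of L2fun acts as its restriction to D. *)
Definition L2 : Type := Quotient.quot L2null.

HB.instance Definition _ := Choice.on L2.
HB.instance Definition _ := GRing.Zmodule.on L2.
HB.instance Definition _ := EqQuotient.on L2.
HB.instance Definition _ := ZmodQuotient.on L2.

Lemma L2_eqP (f g : L2fun) :
  reflect (f - g \in L2null) (\pi_L2 f == \pi_L2 g :> L2).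
Proof. by rewrite -Quotient.idealrBE; exact: idP. Qed.

Lemma L2ind (P : L2 -> Prop) : (forall f : L2fun, P (\pi_L2 f)) -> forall w, P w.
Proof. by move=> Pf w; rewrite -[w]reprK. Qed.

Definition L2scale (a : R[i]) (w : L2) : L2 := \pi_L2 (a *: repr w).

Lemma pi_L2scale a (f : L2fun) : \pi_L2 (a *: f) = L2scale a (\pi_L2 f).
Proof.
apply/eqP/L2_eqP; rewrite -scalerBr rpredZ //; apply/L2_eqP.
by rewrite reprK.
Qed.

Lemma L2scaleA a b (w : L2) : L2scale a (L2scale b w) = L2scale (a * b) w.
Proof. by elim/L2ind: w => f; rewrite -!pi_L2scale scalerA. Qed.

Lemma L2scale1 : left_id 1 L2scale.
Proof. by elim/L2ind => f; rewrite -pi_L2scale scale1r. Qed.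

Lemma L2scaleDr : right_distributive L2scale +%R.
Proof.
move=> a; elim/L2ind => f; elim/L2ind => g.
by rewrite -raddfD -!pi_L2scale -raddfD scalerDr.
Qed.

Lemma L2scaleDl (w : L2) : {morph L2scale^~ w : a b / a + b}.
Proof. by elim/L2ind: w => f a b; rewrite -!pi_L2scale -raddfD scalerDl. Qed.

HB.instance Definition _ := GRing.Zmodule_isLmodule.Build R[i] L2
  L2scaleA L2scale1 L2scaleDr L2scaleDl.

Definition cintegral f : R[i] :=
  (\int[mu]_(x in D) Re (f x)) +i* (\int[mu]_(x in D) Im (f x)).

Definition L2fun_ip (f g : L2fun) : R[i] :=
  cintegral (fun x => f x * (g x)^*%C).

Lemma L2funP (f : L2fun) : sqintegrable f.
Proof. exact/L2predP/valP. Qed.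

Lemma L2fun_mul_integrable (f g : L2fun) :
  mu.-integrable D (EFin \o (fun x => Re (f x * (g x)^*%C))) /\
  mu.-integrable D (EFin \o (fun x => Im (f x * (g x)^*%C))).
Proof.
have /sqintegrableE[rf jf] := L2funP f; have /sqintegrableE[rg jg] := L2funP g.
split.
- have := integrableD mD (sqintM rf rg) (sqintM jf jg).
  apply: eq_integrable => // x _ /=; rewrite -EFinD; congr EFin.
  by case: (f x) (g x) => [? ?] [? ?] /=; ring.
- have := integrableB mD (sqintM jf rg) (sqintM rf jg).
  apply: eq_integrable => // x _ /=; rewrite -EFinB; congr EFin.
  by case: (f x) (g x) => [? ?] [? ?] /=; ring.
Qed.

Lemma L2fun_ipC (f g : L2fun) : L2fun_ip f g = (L2fun_ip g f)^*%C.
Proof.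
have [_ i] := L2fun_mul_integrable g f.
rewrite /L2fun_ip /cintegral /=; congr Complex.
  by apply: eq_Rintegral => x _; case: (f x) (g x) => [? ?] [? ?] /=; ring.
rewrite -mulN1r -RintegralZl //.
by apply: eq_Rintegral => x _; case: (f x) (g x) => [? ?] [? ?] /=; ring.
Qed.

Lemma L2fun_ipPl (a : R[i]) (f g h : L2fun) :
  L2fun_ip (a *: f + g) h = a * L2fun_ip f h + L2fun_ip g h.
Proof.
have [rf jf] := L2fun_mul_integrable f h.
have [rg jg] := L2fun_mul_integrable g h.
have rZ u (r : R) : mu.-integrable D (EFin \o u) ->
    mu.-integrable D (EFin \o (fun x => r * u x)).
  by move=> iu; exact: (integrableZl mD r iu).
case: a => r s; rewrite /L2fun_ip /cintegral.
have iB u v : mu.-integrable D (EFin \o u) -> mu.-integrable D (EFin \o v) ->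
    mu.-integrable D (EFin \o (fun x => u x - v x)).
  by move=> iu iv; exact: (integrableB mD iu iv).
have iD u v : mu.-integrable D (EFin \o u) -> mu.-integrable D (EFin \o v) ->
    mu.-integrable D (EFin \o (fun x => u x + v x)).
  by move=> iu iv; exact: (integrableD mD iu iv).
apply/eqP; rewrite eq_complex /= -!RintegralZl //.
apply/andP; split; apply/eqP.
- rewrite -RintegralB ?rZ // -RintegralD ?iB ?rZ //.
  apply: eq_Rintegral => x _; rewrite -[LHS]/(Re (((r +i* s) * f x + g x) * (h x)^*%C)).
  by case: (f x) (g x) (h x) => [? ?] [? ?] [? ?] /=; ring.
- rewrite -RintegralD ?rZ // -RintegralD ?iD ?rZ //.
  apply: eq_Rintegral => x _; rewrite -[LHS]/(Im (((r +i* s) * f x + g x) * (h x)^*%C)).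
  by case: (f x) (g x) (h x) => [? ?] [? ?] [? ?] /=; ring.
Qed.

Lemma L2fun_ip_null (f g : L2fun) : f \in L2null -> L2fun_ip f g = 0.
Proof.
move=> /L2nullP f0; rewrite /L2fun_ip /cintegral.
have [/integrableP[mr _] /integrableP[mi _]] := L2fun_mul_integrable f g.
congr Complex; rewrite /Rintegral (ae_eq_integral (cst 0%E)) ?integral_cst0 //=;
  rewrite ?integral0 //; apply: filterS f0 => x fx Dx /=; rewrite fx //;
  by case: (g x) => a b /=; rewrite !mul0r ?addr0 ?subr0.
Qed.

Lemma L2fun_ipB (f g h : L2fun) :
  L2fun_ip (f - g) h = L2fun_ip f h - L2fun_ip g h.
Proof. by rewrite addrC -scaleN1r L2fun_ipPl mulN1r addrC. Qed.

Lemma L2fun_ip_eql (f g h : L2fun) :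
  f - g \in L2null -> L2fun_ip f h = L2fun_ip g h.
Proof. by move=> fg; apply/subr0_eq; rewrite -L2fun_ipB L2fun_ip_null. Qed.

Lemma L2fun_ip_gt0 (f : L2fun) : f \notin L2null -> 0 < L2fun_ip f f.
Proof.
have [mr mi i] := L2funP f.
have -> : L2fun_ip f f = (\int[mu]_(x in D) (cabs (f x) ^+ 2))%:C%C.
  rewrite /L2fun_ip /cintegral; congr Complex.
    apply: eq_Rintegral => x _; rewrite cabs2.
    by case: (f x) => ? ? /=; ring.
  rewrite (@eq_Rintegral _ _ _ _ _ (cst 0)) => [|x _]; last first.
    by case: (f x) => ? ? /=; ring.
  by rewrite /Rintegral /= integral0.
rewrite ltcR lt0r Rintegral_ge0 ?andbT; last by move=> x _; exact: sqr_ge0.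
apply: contra => /eqP int0; apply/L2nullP.
have /integrableP[mf fi] := i.
have : (\int[mu]_(x in D) `|(cabs (f x) ^+ 2)%:E| = 0)%E.
  have -> : (\int[mu]_(x in D) `|(cabs (f x) ^+ 2)%:E|
             = \int[mu]_(x in D) (cabs (f x) ^+ 2)%:E)%E.
    by apply: eq_integral => x _; rewrite gee0_abs // lee_fin sqr_ge0.
  rewrite -[LHS]fineK ?integrable_fin_num //.
  by rewrite -[fine _]/(Rintegral _ _ _) int0.
move/(ae_eq_integral_abs mu mD mf); apply: filterS => x fx0 Dx.
have /eqP := fx0 Dx; rewrite eqe sqrf_eq0 => /eqP.
exact: Normc.eq0_normc.
Qed.

Definition L2ip (v w : L2) : R[i] := L2fun_ip (repr v) (repr w).

Lemma L2ip_pi (f g : L2fun) : L2ip (\pi_L2 f) (\pi_L2 g) = L2fun_ip f g.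
Proof.
have E h : repr (\pi_L2 h) - h \in L2null by apply/L2_eqP; rewrite reprK.
rewrite /L2ip (L2fun_ip_eql _ (E f)) L2fun_ipC (L2fun_ip_eql _ (E g)).
by rewrite -L2fun_ipC.
Qed.

Lemma L2ipC (v w : L2) : L2ip v w = (L2ip w v)^*%C.
Proof. exact: L2fun_ipC. Qed.

Lemma L2ipPl (w : L2) : linear_for *%R (L2ip^~ w).
Proof.
move=> a; elim/L2ind => f; elim/L2ind => g; elim/L2ind: w => h.
rewrite -[a *: _]/(L2scale _ _) -pi_L2scale -raddfD !L2ip_pi; exact: L2fun_ipPl.
Qed.

Lemma L2ipPr (v : L2) : linear_for (Num.conj \; *%R) (L2ip v).
Proof.
move=> a x y; rewrite L2ipC L2ipPl (L2ipC v x) (L2ipC v y).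
by rewrite -[LHS]/(Num.conj _) rmorphD rmorphM.
Qed.

HB.instance Definition _ := bilinear_isBilinear.Build R[i] L2 L2 R[i]
  *%R (Num.conj \; *%R) L2ip (L2ipPl, L2ipPr).

Lemma L2ip_herm (v w : L2) : L2ip v w = (-1) ^+ false * Num.conj (L2ip w v).
Proof. by rewrite expr0 mul1r; exact: L2ipC. Qed.

HB.instance Definition _ :=
  isHermitianSesquilinear.Build R[i] L2 false Num.conj L2ip L2ip_herm.

Lemma L2ip_gt0 (w : L2) : w != 0 -> 0 < L2ip w w.
Proof.
elim/L2ind: w => f f0; rewrite L2ip_pi L2fun_ip_gt0 //; apply: contra f0 => f0.
by rewrite -(raddf0 \pi_L2); apply/L2_eqP; rewrite subr0.
Qed.

HB.instance Definition _ := isDotProduct.Build R[i] L2 L2ip L2ip_gt0.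

End SquareIntegrable.

Arguments L2ip {d T R} mu {D} mD v w.

Section Exponentials.
Context (R : realType).

Definition expfun (l x : R) : R[i] :=
  cos (2 * pi * l * x) +i* sin (2 * pi * l * x).

Lemma expfun_L2 (D : set R) (mD : measurable D) (l : R) :
  (lebesgue_measure D < +oo)%E -> expfun l \in L2pred lebesgue_measure mD.
Proof.
move=> Dfin; apply/L2predP; split.
- apply: measurable_funTS; apply: continuous_measurable_fun => x.
  apply: continuous_comp; last exact: continuous_cos.
  exact: mulrl_continuous.
- apply: measurable_funTS; apply: continuous_measurable_fun => x.
  apply: continuous_comp; last exact: continuous_sin.
  exact: mulrl_continuous.
- have : lebesgue_measure.-integrable D (EFin \o cst (1 : R)).
    by apply: measurable_bounded_integrable => //; exact: bounded_cst.
  by apply: eq_integrable => // x _; rewrite cabs2 /= cos2Dsin2.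
Qed.

Definition unit_intervals (M : nat) (a : nat -> int) : set R :=
  \bigcup_(k < M) `[(a k)%:~R, (a k)%:~R + 1[%classic.

Lemma measurable_unit_intervals M a : measurable (unit_intervals M a).
Proof. by apply: bigcup_measurable => k _; exact: measurable_itv. Qed.

Lemma unit_intervals_lty M a : (lebesgue_measure (unit_intervals M a) < +oo)%E.
Proof.
rewrite /unit_intervals bigcup_mkord.
apply: (le_lt_trans (@Boole_inequality _ _ _ lebesgue_measure
    (fun k : nat => `[(a k)%:~R, (a k)%:~R + 1[%classic) M _)) => [k _|].
  exact: measurable_itv.
rewrite (eq_bigr (fun=> 1%:E)) => [|k _]; first by rewrite sumEFin ltry.
by rewrite [LHS]lebesgue_measure_itv /= lte_fin ltrDl ltr01 -EFinB addrAC subrr add0r.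
Qed.

(* The class of x |-> e^{2 pi i l x} in L^2(unit_intervals M a). *)
Definition expL2 (M : nat) (a : nat -> int) (l : R) :
    L2 lebesgue_measure (measurable_unit_intervals M a) :=
  \pi_(L2 lebesgue_measure (measurable_unit_intervals M a))
    (MkL2fun (expfun_L2 (measurable_unit_intervals M a) l
                        (unit_intervals_lty M a))).

End Exponentials.

Arguments unit_intervals : clear implicits.
Arguments measurable_unit_intervals : clear implicits.

(* Main.v *)
(** Write f_k(t) = f(t + a_k) for t in [0, 1[.  Since n a_k is an integer, the inner
product of f with the exponential of frequency n + j/N is the n-th Fourier
coefficient on [0, 1[ of exp(-2 pi i j t / N) (W f_*(t))_j, where W = (z_k^j) is the
square Vandermonde matrix with nodes z_k = exp(-2 pi i a_k / N).  The nodes are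
distinct because the integers a_k are distinct modulo N, so W is invertible and
|W v|^2 is comparable to |v|^2; integrating over t and applying Parseval's identity
gives the frame bounds.  Dually, on the k-th interval a finite combination of the
exponentials is the k-th entry of W^* applied to the vector of its N-modulated
trigonometric polynomials, whose L^2 norms are the norms of the coefficients.

Parseval's identity on [0, 1[ rests on the density of trigonometric polynomials.
The bounded functions in their L^2 closure form an algebra closed under bounded
pointwise limits; it contains x |-> sg (sin (2 pi (x - b))), hence indicators of
intervals, hence of all Borel sets. *)

Require Import Defs.
From mathcomp Require Import all_boot all_order all_algebra finmap.
From mathcomp Require Import all_classical all_reals all_analysis complex.
From mathcomp Require Import measurable_realfun ring lra.
Import Order.TTheory GRing.Theory Num.Theory.
Import numFieldNormedType.Exports.

Set Implicit Arguments.
Unset Strict Implicit.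
Unset Printing Implicit Defensive.

Local Open Scope classical_set_scope.
Local Open Scope ring_scope.
Local Open Scope complex_scope.
Local Open Scope quotient_scope.

Local Notation Re := (@complex.Re _).
Local Notation Im := (@complex.Im _).
Local Notation cabs := (@Normc.normc _).
Local Notation mu := lebesgue_measure.

(** * Inequalities for squared moduli of complex numbers *)

Section ComplexModulus.
Context (R : realType).
Implicit Types x y z : R[i].

Lemma cabs_ge0 z : 0 <= cabs z.
Proof. by case: z => a b /=; exact: sqrtr_ge0. Qed.

Lemma cabs2D x y : cabs (x + y) ^+ 2 <= 2 * cabs x ^+ 2 + 2 * cabs y ^+ 2.
Proof.
rewrite !cabs2; case: x y => [a b] [c d] /=.
have := sqr_ge0 (a - c); have := sqr_ge0 (b - d); nra.
Qed.

Lemma cabs2M x y : cabs (x * y) ^+ 2 = cabs x ^+ 2 * cabs y ^+ 2.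
Proof. by rewrite Normc.normcM exprMn. Qed.

Lemma cabs_conjc z : cabs z^*%C = cabs z.
Proof. by case: z => a b; rewrite /= sqrrN. Qed.

Lemma cabs2_real (r : R) : cabs r%:C ^+ 2 = r ^+ 2.
Proof. by rewrite cabs2 /= expr0n addr0. Qed.

Lemma cabs2_prod z : z * z^*%C = (cabs z ^+ 2)%:C.
Proof.
rewrite cabs2; case: z => a b; apply/eqP; rewrite eq_complex /=.
by apply/andP; split; apply/eqP; ring.
Qed.

Lemma Re_sum (I : finType) (F : I -> R[i]) : Re (\sum_i F i) = \sum_i Re (F i).
Proof. by apply: (big_morph (@complex.Re R)) => // -[? ?] []. Qed.

Lemma Im_sum (I : finType) (F : I -> R[i]) : Im (\sum_i F i) = \sum_i Im (F i).
Proof. by apply: (big_morph (@complex.Im R)) => // -[? ?] []. Qed.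

(** Cauchy-Schwarz against the constant family 1, applied to the real and to the imaginary parts. *)
Lemma cabs2_sum (I : finType) (F : I -> R[i]) :
  cabs (\sum_i F i) ^+ 2 <= #|I|%:R * \sum_i cabs (F i) ^+ 2.
Proof.
have rsum (u : I -> R) : (\sum_i u i) ^+ 2 <= #|I|%:R * \sum_i u i ^+ 2.
  (* Lagrange's identity: this nonnegative double sum is twice the defect in the Cauchy-Schwarz
     inequality. *)
  have : 0 <= \sum_i \sum_j (u i - u j) ^+ 2.
    by apply: sumr_ge0 => i _; apply: sumr_ge0 => j _; exact: sqr_ge0.
  have -> : \sum_i \sum_j (u i - u j) ^+ 2 =
      2 * (#|I|%:R * \sum_i u i ^+ 2 - (\sum_i u i) ^+ 2).
    have E i : \sum_j (u i - u j) ^+ 2 =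
        #|I|%:R * u i ^+ 2 + \sum_j u j ^+ 2 - 2 * \sum_j u j * u i.
      have sqE j : (u i - u j) ^+ 2 = u i ^+ 2 + u j ^+ 2 - 2 * (u j * u i) by ring.
      under eq_bigr do rewrite sqE.
      by rewrite sumrB big_split /= sumr_const -mulr_sumr -[_ *+ #|I|]mulr_natl.
    under eq_bigr do rewrite E -mulr_suml.
    rewrite sumrB big_split /= sumr_const -!mulr_sumr -[X in _ + X - _]mulr_natl.
    ring.
  by rewrite pmulr_rge0 // subr_ge0.
rewrite cabs2 Re_sum Im_sum; rewrite [in leRHS](eq_bigr _ (fun i _ => cabs2 (F i))).
by rewrite big_split mulrDr lerD.
Qed.

End ComplexModulus.

(** * Square integrals of complex-valued functions *)

Section SquareIntegral.
Context (R : realType) (D : set R) (mD : measurable D).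
Implicit Types f g : R -> R[i].

Definition cmeasurable f :=
  measurable_fun D (Re \o f) /\ measurable_fun D (Im \o f).

(** With values in the extended reals, the estimates below ask only for measurability; finiteness is
    settled later, where Parseval's identity or a class of [L2] calls for it. *)
Definition L2sq f : \bar R := \int[mu]_(x in D) (cabs (f x) ^+ 2)%:E.

Lemma cmeasurableD f g : cmeasurable f -> cmeasurable g ->
  cmeasurable (fun x => f x + g x).
Proof.
move=> [f1 f2] [g1 g2]; split.
- apply: (eq_measurable_fun _ _ (measurable_funD f1 g1)) => x _ /=.
  by case: (f x) (g x) => [? ?] [].
- apply: (eq_measurable_fun _ _ (measurable_funD f2 g2)) => x _ /=.
  by case: (f x) (g x) => [? ?] [].
Qed.

Lemma cmeasurableM f g : cmeasurable f -> cmeasurable g ->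
  cmeasurable (fun x => f x * g x).
Proof.
move=> [f1 f2] [g1 g2]; split.
- apply: (eq_measurable_fun _ _
    (measurable_funB (measurable_funM f1 g1) (measurable_funM f2 g2))) => x _ /=.
  by case: (f x) (g x) => [? ?] [].
- apply: (eq_measurable_fun _ _
    (measurable_funD (measurable_funM f1 g2) (measurable_funM f2 g1))) => x _ /=.
  by case: (f x) (g x) => [? ?] [].
Qed.

Lemma cmeasurable_real (u : R -> R) :
  measurable_fun D u -> cmeasurable (fun x => (u x)%:C).
Proof. by split => //; exact: measurable_cst. Qed.

Lemma cmeasurable_cst (c : R[i]) : cmeasurable (fun=> c).
Proof. by split; exact: measurable_cst. Qed.

Lemma cmeasurableB f g : cmeasurable f -> cmeasurable g ->
  cmeasurable (fun x => f x - g x).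
Proof.
move=> mf mg; apply: cmeasurableD => //.
have := cmeasurableM (cmeasurable_cst (-1)) mg.
by under eq_fun do rewrite mulN1r.
Qed.

Lemma cmeasurable_conj f : cmeasurable f -> cmeasurable (fun x => (f x)^*%C).
Proof.
move=> [f1 f2]; split.
  by apply: (eq_measurable_fun _ _ f1) => x _ /=; case: (f x).
apply: (eq_measurable_fun _ _ (measurableT_comp (@oppr_measurable R setT) f2)) => x _ /=.
by case: (f x).
Qed.

Lemma cmeasurable_sum (I : Type) (s : seq I) (F : I -> R -> R[i]) :
  (forall i, cmeasurable (F i)) -> cmeasurable (fun x => \sum_(i <- s) F i x).
Proof.
move=> mF; elim: s => [|i s IHs].
  by under eq_fun do rewrite big_nil; exact: cmeasurable_cst.
by under eq_fun do rewrite big_cons; exact: cmeasurableD.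
Qed.

Lemma measurable_cabs2 f : cmeasurable f ->
  measurable_fun D (fun x => cabs (f x) ^+ 2).
Proof.
move=> [f1 f2]; apply: (eq_measurable_fun _ _
  (measurable_funD (measurable_funX 2 f1) (measurable_funX 2 f2))) => x _ /=.
by rewrite cabs2.
Qed.

Let measurable_cabs2E f : cmeasurable f ->
  measurable_fun D (fun x => (cabs (f x) ^+ 2)%:E).
Proof. by move=> mf; apply/measurable_EFinP; exact: measurable_cabs2. Qed.

Lemma L2sqD f g : cmeasurable f -> cmeasurable g ->
  (L2sq (fun x => f x + g x)%R <= 2%:E * L2sq f + 2%:E * L2sq g)%E.
Proof.
move=> mf mg.
have ge0 h x : (0%R <= (cabs (h x : R[i]) ^+ 2)%:E)%E by rewrite lee_fin sqr_ge0.
rewrite /L2sq -!ge0_integralZl //; [|exact: measurable_cabs2E..].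
rewrite -ge0_integralD //.
- apply: ge0_le_integral => //.
  + exact: (measurable_cabs2E (cmeasurableD mf mg)).
  + by apply: emeasurable_funD; apply/measurable_EFinP;
      apply: measurable_funM => //; exact: measurable_cabs2.
  + by move=> x _; rewrite -!EFinM -EFinD lee_fin cabs2D.
- by move=> x _; rewrite mule_ge0.
- by apply/measurable_EFinP; apply: measurable_funM => //; exact: measurable_cabs2.
- by move=> x _; rewrite mule_ge0.
- by apply/measurable_EFinP; apply: measurable_funM => //; exact: measurable_cabs2.
Qed.

Lemma L2sqM (C : R) f g : cmeasurable f -> cmeasurable g ->
  (forall x, D x -> cabs (f x) <= C) ->
  (L2sq (fun x => f x * g x)%R <= (C ^+ 2)%:E * L2sq g)%E.
Proof.
move=> mf mg fC; rewrite /L2sq -ge0_integralZl //.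
- apply: ge0_le_integral => //.
  + by move=> x _; rewrite lee_fin sqr_ge0.
  + exact: (measurable_cabs2E (cmeasurableM mf mg)).
  + by apply/measurable_EFinP; apply: measurable_funM => //; exact: measurable_cabs2.
  + move=> x Dx; rewrite -EFinM lee_fin cabs2M ler_wpM2r ?sqr_ge0 //.
    by rewrite lerXn2r ?nnegrE ?cabs_ge0 ?fC // (le_trans (cabs_ge0 _) (fC _ Dx)).
- exact: measurable_cabs2E.
- by move=> x _; rewrite lee_fin sqr_ge0.
- by rewrite lee_fin sqr_ge0.
Qed.

Lemma L2sq_real (u : R -> R) :
  L2sq (fun x => (u x)%:C) = (\int[mu]_(x in D) (u x ^+ 2)%:E)%E.
Proof. by apply: eq_integral => x _; rewrite cabs2_real. Qed.

End SquareIntegral.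

(** * The $L^2$ closure of the trigonometric polynomials on $[0, 1[$ *)

Section TrigonometricDensity.
Context (R : realType).
Implicit Types (f g : R -> R[i]) (u v : R -> R).

Local Notation T1 := (`[0 : R, 1[%classic).

Inductive trigpoly : (R -> R[i]) -> Prop :=
| trigpoly_exp (n : int) : trigpoly (expfun n%:~R)
| trigpoly_lin (c : R[i]) p q : trigpoly p -> trigpoly q ->
    trigpoly (fun x => c * p x + q x).

(** The tolerance [e] bounds the squared distance. Measurability of the approximant is recorded
    because the estimates for [L2sq] ask for it. *)
Definition L2closure (D : set R) (S : (R -> R[i]) -> Prop) f :=
  cmeasurable D f /\ forall e : R, 0 < e ->
    exists2 p, cmeasurable D p /\ S p & (L2sq D (fun x => (f x - p x)%R) < e%:E)%E.

Definition trig_approx := L2closure T1 trigpoly.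

Lemma expfunD (a b x : R) : expfun (a + b) x = expfun a x * expfun b x.
Proof.
rewrite /expfun mulrDr mulrDl cosD sinD; apply/eqP; rewrite eq_complex /=.
by apply/andP; split; apply/eqP; ring.
Qed.

Lemma expfunDr (a x y : R) : expfun a (x + y) = expfun a x * expfun a y.
Proof.
rewrite /expfun mulrDr cosD sinD; apply/eqP; rewrite eq_complex /=.
by apply/andP; split; apply/eqP; ring.
Qed.

Lemma expfun0 (x : R) : expfun 0 x = 1.
Proof. by rewrite /expfun mulr0 mul0r cos0 sin0. Qed.

Lemma expfunN (a x : R) : expfun (- a) x = (expfun a x)^*%C.
Proof. by rewrite /expfun mulrN mulNr cosN sinN. Qed.

Lemma cabs_expfun (a x : R) : cabs (expfun a x) = 1.
Proof. by rewrite /= cos2Dsin2 sqrtr1. Qed.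

Lemma cmeasurable_expfun (D : set R) (a : R) : cmeasurable D (expfun a).
Proof.
split; apply: measurable_funTS; apply: continuous_measurable_fun => x;
  (apply: continuous_comp; first exact: mulrl_continuous).
- exact: continuous_cos.
- exact: continuous_sin.
Qed.

Lemma cmeasurable_trigpoly (D : set R) p : trigpoly p -> cmeasurable D p.
Proof.
elim=> [n|c {}p q _ mp _ mq]; first exact: cmeasurable_expfun.
by apply: cmeasurableD mq; apply: cmeasurableM mp; exact: cmeasurable_cst.
Qed.

(** Zero is not a constructor of [trigpoly]; every constant arises as $(c - 1) \cdot 1 + 1$ from the
    exponential of frequency 0. *)
Lemma trigpoly_cst c : trigpoly (fun=> c).
Proof.
have := trigpoly_lin (c - 1) (trigpoly_exp 0) (trigpoly_exp 0).
congr trigpoly; apply/funext => x.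
by rewrite expfun0 mulr1 subrK.
Qed.

(** Frequencies add under multiplication, and bilinearity does the rest: induction on [p] for all
    [q], then on [q]. *)
Lemma trigpolyM p q : trigpoly p -> trigpoly q -> trigpoly (fun x => p x * q x).
Proof.
move=> tp; elim: tp q => [n|c {}p p' _ IHp _ IHq] r; last first.
  move=> tr; have := trigpoly_lin c (IHp _ tr) (IHq _ tr).
  by congr trigpoly; apply/funext => x; rewrite mulrDl mulrA.
elim=> [m|c {}p {}r _ IHp _ IHq].
  have := trigpoly_exp (n + m); congr trigpoly; apply/funext => x.
  by rewrite intrD expfunD.
have := trigpoly_lin c IHp IHq; congr trigpoly; apply/funext => x.
by rewrite mulrDr; congr (_ + _); ring.
Qed.

Let mT1 : measurable T1. Proof. exact: measurable_itv. Qed.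

Lemma trigpoly_bounded p : trigpoly p -> exists C : R, forall x, cabs (p x) <= C.
Proof.
elim=> [n|c {}p q _ [C pC] _ [C' qC']]; first by exists 1 => x; rewrite cabs_expfun.
exists (cabs c * C + C') => x; apply: le_trans (le_normcD _ _) _.
by rewrite Normc.normcM lerD // ler_wpM2l ?cabs_ge0.
Qed.

(** The closure is closed. Tolerances of $e/4$ compensate for the factor 2 that [L2sqD] puts on each
    of the two errors. *)
Lemma trig_approx_closed f : cmeasurable T1 f ->
  (forall e : R, 0 < e -> exists2 g, trig_approx g &
    (L2sq T1 (fun x => (f x - g x)%R) < e%:E)%E) -> trig_approx f.
Proof.
move=> mf fg; split=> // e e0.
have e4 : 0 < e / 4 by rewrite divr_gt0.
have [g [mg gp] fge] := fg _ e4; have [p [mp tp] gpe] := gp _ e4.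
exists p => //.
have -> : (fun x => (f x - p x)%R) = (fun x => (f x - g x) + (g x - p x))%R.
  by apply/funext => x; ring.
apply: le_lt_trans (L2sqD mT1 (cmeasurableB mf mg) (cmeasurableB mg mp)) _.
have -> : e%:E = (2%:E * (e / 4)%:E + 2%:E * (e / 4)%:E)%E.
  by rewrite -!EFinM -EFinD; congr EFin; lra.
by rewrite lteD // lte_pmul2l.
Qed.

Lemma trig_approx_trigpoly p : trigpoly p -> trig_approx p.
Proof.
move=> tp; have mp := cmeasurable_trigpoly T1 tp; split=> // e e0; exists p => //.
rewrite /L2sq integral0_eq ?lte_fin // => x _.
by rewrite subrr Normc.normc0 expr0n.
Qed.

Lemma trig_approx_lin c f g : trig_approx f -> trig_approx g ->
  trig_approx (fun x => c * f x + g x).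
Proof.
move=> [mf fp] [mg gq].
have mcf : cmeasurable T1 (fun x => c * f x).
  by apply: cmeasurableM mf; exact: cmeasurable_cst.
split; first exact: cmeasurableD mg.
(* Adding 1 keeps [C] positive when $c = 0$, so that the tolerance for [f] can be divided by
   $C^2$. *)
move=> e e0; pose C := cabs c + 1.
have C0 : 0 < C by rewrite ltr_wpDl ?cabs_ge0.
have e1 : 0 < e / 4 / C ^+ 2 by rewrite !divr_gt0 // exprn_gt0.
have e4 : 0 < e / 4 by rewrite divr_gt0.
have [p [mp tp] fpe] := fp _ e1; have [q [mq tq] gqe] := gq _ e4.
have tr := trigpoly_lin c tp tq.
exists (fun x => c * p x + q x); first by split=> //; exact: cmeasurable_trigpoly.
have -> : (fun x => (c * f x + g x - (c * p x + q x))%R) =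
    (fun x => c * (f x - p x) + (g x - q x))%R.
  by apply/funext => x; ring.
have mc := cmeasurable_cst T1 c.
apply: le_lt_trans (L2sqD mT1 (cmeasurableM mc (cmeasurableB mf mp)) (cmeasurableB mg mq)) _.
have -> : e%:E = (2%:E * (e / 4)%:E + 2%:E * (e / 4)%:E)%E.
  by rewrite -!EFinM -EFinD; congr EFin; lra.
rewrite lteD // lte_pmul2l //.
apply: le_lt_trans (L2sqM mT1 mc (cmeasurableB mf mp) (C := C) _) _.
  by move=> x _; rewrite /C lerDl.
have -> : (e / 4)%:E = ((C ^+ 2)%:E * (e / 4 / C ^+ 2)%:E)%E.
  by rewrite -EFinM mulrCA divff ?mulr1 // expf_neq0 // gt_eqF.
by rewrite lte_pmul2l // lte_fin exprn_gt0.
Qed.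

(** One bounded factor is enough. For a polynomial [p], approximate [g] and use that [p] is bounded;
    then replace [f] by a nearby [p], where the error $(f - p) g$ is controlled by the bound on
    [g]. *)
Lemma trig_approxM f g (C : R) : trig_approx f -> trig_approx g ->
  (forall x, T1 x -> cabs (g x) <= C) -> trig_approx (fun x => f x * g x).
Proof.
move=> af ag gC; have [mf fp] := af; have [mg gq] := ag.
have mul_p p : trigpoly p -> trig_approx (fun x => p x * g x).
  move=> tp; have [K pK] := trigpoly_bounded tp.
  have mp := cmeasurable_trigpoly T1 tp.
  apply: trig_approx_closed; first exact: cmeasurableM.
  move=> e e0.
  have K0 : 0 < `|K| + 1 by rewrite ltr_wpDl.
  have e1 : 0 < e / (`|K| + 1) ^+ 2 by rewrite !divr_gt0 // exprn_gt0.
  have [q [mq tq] gqe] := gq _ e1; exists (fun x => p x * q x).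
    exact/trig_approx_trigpoly/trigpolyM.
  under [X in L2sq _ X]eq_fun do rewrite -mulrBr.
  apply: le_lt_trans (L2sqM mT1 mp (cmeasurableB mg mq) (C := `|K| + 1) _) _.
    by move=> x _; rewrite (le_trans (pK x)) // (le_trans (ler_norm _)) // lerDl.
  have -> : e%:E = (((`|K| + 1) ^+ 2)%:E * (e / (`|K| + 1) ^+ 2)%:E)%E.
    by rewrite -EFinM mulrCA divff ?mulr1 // expf_neq0 // gt_eqF.
  by rewrite lte_pmul2l // lte_fin exprn_gt0.
apply: trig_approx_closed; first exact: cmeasurableM.
move=> e e0.
have K0 : 0 < `|C| + 1 by rewrite ltr_wpDl.
have e1 : 0 < e / (`|C| + 1) ^+ 2 by rewrite !divr_gt0 // exprn_gt0.
have [p [mp tp] fpe] := fp _ e1; exists (fun x => p x * g x); first exact: mul_p.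
under [X in L2sq _ X]eq_fun do rewrite -mulrBl mulrC.
apply: le_lt_trans (L2sqM mT1 mg (cmeasurableB mf mp) (C := `|C| + 1) _) _.
  by move=> x Dx; rewrite (le_trans (gC _ Dx)) // (le_trans (ler_norm _)) // lerDl.
have -> : e%:E = (((`|C| + 1) ^+ 2)%:E * (e / (`|C| + 1) ^+ 2)%:E)%E.
  by rewrite -EFinM mulrCA divff ?mulr1 // expf_neq0 // gt_eqF.
by rewrite lte_pmul2l // lte_fin exprn_gt0.
Qed.

(** The bound [g] passes to the limit, so $(u - u_n)^2 \le 4 g^2$, and dominated convergence makes
    the squared distances tend to 0. *)
Lemma trig_approx_dominated (u_ : nat -> R -> R) u (g : R -> R) :
  (forall n, trig_approx (fun x => (u_ n x)%:C)) ->
  measurable_fun T1 u ->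
  (forall x, T1 x -> u_ ^~ x @ \oo --> u x) ->
  (forall n x, T1 x -> `|u_ n x| <= g x) ->
  mu.-integrable T1 (fun x => (g x ^+ 2)%:E) ->
  trig_approx (fun x => (u x)%:C).
Proof.
move=> au mu1 cvu ug ig.
have mu_ n : measurable_fun T1 (u_ n) by have [[]] := au n.
apply: trig_approx_closed; first exact: cmeasurable_real.
have leug x : T1 x -> `|u x| <= g x.
  move=> Dx.
  have cn : `|u_ n x| @[n --> \oo] --> `|u x| by apply: cvg_norm; exact: cvu.
  rewrite -(cvg_lim (@Rhausdorff R) cn); apply: limr_le; first by apply/cvg_ex; exists `|u x|.
  by apply: nearW => n; exact: ug.
have i4 : mu.-integrable T1 (fun x => (4 * g x ^+ 2)%:E).
  rewrite (_ : (fun _ => _) = (fun x => 4%:E * (g x ^+ 2)%:E)%E); first exact: integrableZl.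
  by apply/funext => x; rewrite EFinM.
have := @dominated_convergence _ _ _ lebesgue_measure T1 mT1
  (fun n x => ((u x - u_ n x) ^+ 2)%:E) (cst 0%E) (fun x => (4 * g x ^+ 2)%:E).
case.
- move=> n; apply/measurable_EFinP; exact: (measurable_funX 2 (measurable_funB mu1 (mu_ n))).
- exact: measurable_cst.
- apply: aeW => x Dx; apply: cvg_EFin; first exact: nearW.
  rewrite -[X in _ --> X](_ : (u x - u x) ^+ 2 = 0); last by rewrite subrr expr0n.
  rewrite expr2; under eq_fun do rewrite /= expr2.
  by apply: cvgM; apply: cvgB; [exact: cvg_cst|exact: cvu|exact: cvg_cst|exact: cvu].
- exact: i4.
- apply: aeW => x n Dx; rewrite /= lee_fin ger0_norm ?sqr_ge0 //.
  have := leug _ Dx; have := ug n _ Dx; rewrite !ler_norml.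
  move=> /andP[? ?] /andP[? ?]; nra.
move=> _ _; rewrite integral0 => cv0 e e0.
have /fine_cvgP[fin0 cvf] := cv0.
have : \forall n \near \oo, `|fine (\int[lebesgue_measure]_(x in T1) ((u x - u_ n x) ^+ 2)%:E)| < e.
  exact: (cvgr0_norm_lt _ cvf _ e0).
(* Convergence in the extended reals splits into eventual finiteness and convergence of the finite
   parts; the index [N] serves both. *)
move=> /(filterI fin0) [N _ /(_ N (leqnn N)) [finN ltN]].
exists (fun x => (u_ N x)%:C) => //.
rewrite (_ : (fun _ => _) = (fun x => (u x - u_ N x)%:C)); last first.
  by apply/funext => x; rewrite rmorphB.
rewrite L2sq_real -[ltLHS]fineK // lte_fin; exact: le_lt_trans (ler_norm _) ltN.
Qed.

End TrigonometricDensity.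

(** * Density of trigonometric polynomials *)

(* [s (3 - s^2) / 2] fixes -1, 0 and 1 and moves every other point of [-1, 1]
   towards its sign: the iterates realize [Num.sg] as a bounded pointwise limit
   of polynomials. *)
Section SignIteration.
Context (R : realType).

Definition sgstep (s : R) : R := s * (3 - s ^+ 2) / 2.

Lemma sgstepN s : sgstep (- s) = - sgstep s.
Proof. by rewrite /sgstep sqrrN !mulNr. Qed.

Lemma sgstep_itv s : 0 <= s <= 1 -> s <= sgstep s <= 1.
Proof.
move=> /andP[s0 s1]; apply/andP; split; rewrite -subr_ge0.
- have -> : sgstep s - s = s * (1 - s) * (1 + s) / 2 by rewrite /sgstep; field.
  by rewrite divr_ge0 ?mulr_ge0 //; lra.
- have -> : 1 - sgstep s = (1 - s) ^+ 2 * (2 + s) / 2 by rewrite /sgstep; field.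
  by rewrite divr_ge0 ?mulr_ge0 ?sqr_ge0 //; lra.
Qed.

Lemma iter_sgstepN n s : iter n sgstep (- s) = - iter n sgstep s.
Proof. by elim: n => //= n ->; rewrite sgstepN. Qed.

Lemma iter_sgstep_itv n s : 0 <= s <= 1 -> s <= iter n sgstep s <= 1.
Proof.
move=> s01; elim: n => [|n /andP[IH1 IH2]] /=.
  by rewrite lexx; case/andP: s01.
have s0 : 0 <= s by case/andP: s01.
have := @sgstep_itv (iter n sgstep s); rewrite IH2 (le_trans s0 IH1) => /(_ isT).
by move=> /andP[h1 ->]; rewrite (le_trans IH1).
Qed.

Lemma iter_sgstep_le1 n s : `|s| <= 1 -> `|iter n sgstep s| <= 1.
Proof.
have pos t : 0 <= t <= 1 -> `|iter n sgstep t| <= 1.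
  move=> /[dup] /andP[t0 _] /(@iter_sgstep_itv n)/andP[h1 h2].
  by rewrite ger0_norm // (le_trans t0).
have [s0|s0] := leP 0 s; first by rewrite ger0_norm // => s1; apply: pos; rewrite s0.
rewrite ltr0_norm // => s1; rewrite -[s]opprK iter_sgstepN normrN.
by apply: pos; rewrite s1 oppr_ge0 ltW.
Qed.

Lemma iter_sgstep_cvg s : `|s| <= 1 -> iter n sgstep s @[n --> \oo] --> Num.sg s.
Proof.
have pos t : 0 < t <= 1 -> iter n sgstep t @[n --> \oo] --> (1 : R).
  move=> /andP[t0 t1].
  (* Since every iterate $r$ satisfies $t \le r \le 1$, each step multiplies the distance to 1 by $1
     - r/2 - r^2/2$, which is at most $1 - t/2$. *)
  have dist n : 1 - iter n sgstep t <= (1 - t / 2) ^+ n.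
    elim: n => [|n IHn]; first by rewrite expr0 /= lerBlDr lerDl ltW.
    have /andP[h1 h2] := @iter_sgstep_itv n t (introT andP (conj (ltW t0) t1)).
    have t2 : 0 <= 1 - t / 2 by lra.
    rewrite exprSr /=; apply: le_trans (ler_wpM2r t2 IHn).
    move: (iter n sgstep t) h1 h2 => r h1 h2; rewrite -subr_ge0.
    have -> : (1 - r) * (1 - t / 2) - (1 - sgstep r) = (1 - r) * ((r - t) + r ^+ 2) / 2.
      by rewrite /sgstep; field.
    have h3 : 0 <= 1 - r by lra.
    have h4 : 0 <= r - t + r ^+ 2 by rewrite addr_ge0 ?sqr_ge0 // subr_ge0.
    by rewrite divr_ge0 // mulr_ge0.
  apply: (@squeeze_cvgr _ _ _ _ (fun n => 1 - (1 - t / 2) ^+ n) (cst 1)).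
  - apply: nearW => n; have /andP[h1 h2] := @iter_sgstep_itv n t (introT andP (conj (ltW t0) t1)).
    by rewrite /= h2 andbT lerBlDl -lerBlDr dist.
  - rewrite -[X in _ --> X]subr0; apply: cvgB; first exact: cvg_cst.
    by apply: cvg_expr; rewrite ger0_norm; lra.
  - exact: cvg_cst.
move=> s1; have [s0|s0|->] := ltgtP s 0.
- rewrite -[s]opprK sgrN gtr0_sg ?oppr_gt0 //.
  under eq_fun do rewrite iter_sgstepN.
  by apply: cvgN; apply: pos; rewrite oppr_gt0 s0 -(ltr0_norm s0).
- by rewrite gtr0_sg //; apply: pos; rewrite s0 -(gtr0_norm s0).
- rewrite sgr0 (_ : (fun _ => _) = cst 0); first exact: cvg_cst.
  by apply/funext; elim=> //= n ->; rewrite /sgstep mul0r mul0r.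
Qed.

End SignIteration.

(** * Bounded approximable functions: from the sine to indicators of rays *)

Section IndicatorsAreApproximable.
Context (R : realType).
Implicit Types (f g : R -> R[i]) (u v : R -> R).
Local Notation T1 := (`[0 : R, 1[%classic).

(** Boundedness is built in because [trig_approxM] asks for a bounded factor; with it the class is
    an algebra. *)
Definition bounded_approx u :=
  trig_approx (fun x => (u x)%:C) /\ exists C : R, forall x, `|u x| <= C.

Lemma bounded_approx_cst (c : R) : bounded_approx (fun=> c).
Proof.
split; last by exists `|c|.
exact/trig_approx_trigpoly/trigpoly_cst.
Qed.

Lemma bounded_approxD u v : bounded_approx u -> bounded_approx v ->
  bounded_approx (fun x => u x + v x).
Proof.
move=> [au [C uC]] [av [C' vC']]; split.
  have := trig_approx_lin 1 au av; congr trig_approx; apply/funext => x.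
  by rewrite mul1r rmorphD.
by exists (C + C') => x; rewrite (le_trans (ler_normD _ _)) // lerD.
Qed.

Lemma bounded_approxM u v : bounded_approx u -> bounded_approx v ->
  bounded_approx (fun x => u x * v x).
Proof.
move=> [au [C uC]] [av [C' vC']]; split.
  have : trig_approx (fun x => (u x)%:C * (v x)%:C).
    apply: (trig_approxM (C := C')) => // x _.
    by rewrite /= expr0n addr0 sqrtr_sqr.
  by congr trig_approx; apply/funext => x; rewrite rmorphM.
by exists (C * C') => x; rewrite normrM ler_pM.
Qed.

Lemma bounded_approxB u v : bounded_approx u -> bounded_approx v ->
  bounded_approx (fun x => u x - v x).
Proof.
move=> au av.
have := bounded_approxD au (bounded_approxM (bounded_approx_cst (-1)) av).
by congr bounded_approx; apply/funext => x; rewrite mulN1r.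
Qed.

Lemma bounded_approx_lim (u_ : nat -> R -> R) u (C : R) :
  (forall n, bounded_approx (u_ n)) -> measurable_fun T1 u ->
  (forall x, u_ ^~ x @ \oo --> u x) -> (forall n x, `|u_ n x| <= C) ->
  bounded_approx u.
Proof.
move=> au mu1 cvu uC; split.
  apply: (@trig_approx_dominated _ u_ u (cst C)) => //.
  - by move=> n; case: (au n).
  - have : lebesgue_measure.-integrable T1 (EFin \o cst (C ^+ 2)).
      apply: measurable_bounded_integrable => //.
      + by rewrite [ltLHS]lebesgue_measure_itv /= lte01 oppr0 adde0 ltry.
      + exact: bounded_cst.
    by apply: eq_integrable.
exists C => x.
have cn : `|u_ n x| @[n --> \oo] --> `|u x| by apply: cvg_norm; exact: cvu.
rewrite -(cvg_lim (@Rhausdorff R) cn); apply: limr_le; first by apply/cvg_ex; exists `|u x|.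
by apply: nearW => n; exact: uC.
Qed.

(** Euler's formula: the coefficients $-i/2 = 1/(2i)$ and $i/2$ are rotated by [w] and its conjugate
    to shift the phase by [b]. *)
Lemma bounded_approx_sin (b : R) :
  bounded_approx (fun x => sin (2 * pi * (x - b))).
Proof.
split; last by exists 1 => x; exact: sin_max.
pose w := expfun 1 (- b).
have tp := trigpoly_lin (- 'i%C / 2 * w) (trigpoly_exp R 1)
  (trigpoly_lin ('i%C / 2 * w^*%C) (trigpoly_exp R (-1)) (trigpoly_cst 0)).
have := trig_approx_trigpoly tp; congr trig_approx; apply/funext => x.
rewrite addr0 [(-1)%:~R]mulrNz expfunN.
have -> : (- 'i%C / 2 * w * expfun 1 x + 'i%C / 2 * w^*%C * (expfun 1 x)^*%C) =
  (- 'i%C / 2) * ((expfun 1 x * w) - (expfun 1 x * w)^*%C) :> R[i].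
  by rewrite rmorphM; ring.
rewrite -expfunDr /expfun mulr1; move: (cos _) (sin _) => c s.
rewrite subcJ /=.
have i2 : 'i%C * 'i%C = -1 :> R[i] by rewrite -expr2 sqr_i.
by transitivity (- ('i%C * 'i%C) * s%:C); [field|rewrite i2 opprK mul1r].
Qed.

Lemma bounded_approx_sgstep u :
  bounded_approx u -> bounded_approx (fun x => sgstep (u x)).
Proof.
move=> au; have := bounded_approxM (bounded_approxM au
  (bounded_approxB (bounded_approx_cst 3) (bounded_approxM au au))) (bounded_approx_cst 2^-1).
by congr bounded_approx; apply/funext => x; rewrite /sgstep expr2.
Qed.

(** The iterates of [sgstep] at [u] are polynomials in [u], bounded by 1 and converging pointwise to
    the sign. *)
Lemma bounded_approx_sg u : (forall x, `|u x| <= 1) ->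
  bounded_approx u -> bounded_approx (fun x => Num.sg (u x)).
Proof.
move=> u1 au; apply: (@bounded_approx_lim (fun n x => iter n (@sgstep R) (u x)) _ 1).
- by elim=> //= n IHn; exact: (bounded_approx_sgstep IHn).
- have [[[mu1 _] _] _] := au.
  have -> : (fun x => Num.sg (u x)) =
      (fun x => \1_`]0, +oo[ (u x) - \1_`]-oo, 0[ (u x)).
    apply/funext => x; rewrite !indicE !mem_setE !in_itv /= andbT.
    by case: sgrP => _; rewrite ?subr0 ?sub0r ?subrr.
  apply: measurable_funB; apply: measurableT_comp => //;
    exact: (measurable_indic (measurable_itv _)).
- by move=> x; exact: iter_sgstep_cvg.
- by move=> n x; exact: iter_sgstep_le1.
Qed.

(** Approximation sees only $[0, 1[$. This lets a periodic expression stand for an indicator that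
    agrees with it on a single period. *)
Lemma bounded_approx_ext u v : (forall x, T1 x -> u x = v x) ->
  (exists C : R, forall x, `|v x| <= C) -> bounded_approx u -> bounded_approx v.
Proof.
move=> uv vC [au _]; split=> //; have [[mu1 _] up] := au.
have mT1 : measurable T1 by exact: measurable_itv.
apply: trig_approx_closed.
  apply: cmeasurable_real; apply: eq_measurable_fun mu1 => x.
  by rewrite inE => Dx /=; exact: uv.
move=> e e0; exists (fun x => (u x)%:C) => //.
rewrite /L2sq integral0_eq ?lte_fin // => x Dx.
by rewrite uv // subrr Normc.normc0 expr0n.
Qed.

Lemma indic_bounded (A : set R) : exists C : R, forall x, `|\1_A x : R| <= C.
Proof. by exists 1 => x; rewrite indicE; case: (_ \in _); rewrite ?normr0 ?normr1. Qed.

(** The square wave of period 1: it is 1 on $]b, b + 1/2[$, $-1$ on $]b - 1/2, b[$, and 0 at the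
    jumps. *)
Let sgsin (b x : R) : R := Num.sg (sin (2 * pi * (x - b))).
Let bounded_approx_sgsin b : bounded_approx (sgsin b).
Proof.
by apply: bounded_approx_sg => [x|]; [exact: sin_max|exact: bounded_approx_sin].
Qed.

(* The indicator of [0 < s] when s is one of -1, 0, 1. *)
Let ind_gt0 (s : R) : R := (s ^+ 2 + s) / 2.
Let ind_sgsin_gt0 b : bounded_approx (fun x => ind_gt0 (sgsin b x)).
Proof.
apply: bounded_approxM (bounded_approx_cst _).
apply: bounded_approxD => //; under eq_fun do rewrite expr2.
exact: bounded_approxM.
Qed.

Let sgsin_gt0 (b x : R) : b < x < b + 1 / 2 -> sgsin b x = 1.
Proof.
move=> /andP[bx xb]; apply/gtr0_sg/sin_gt0_pi.
have p0 := @pi_gt0 R; have -> : 2 * pi * (x - b) = pi * (2 * (x - b)) by ring.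
by rewrite mulr_gt0 ?gtr_pMr //; lra.
Qed.

Let sgsin_le0 (b x : R) : b - 1 / 2 <= x <= b -> ind_gt0 (sgsin b x) = 0.
Proof.
move=> /andP[bx xb].
have : sin (2 * pi * (x - b)) <= 0.
  rewrite -[leLHS]opprK -sinN oppr_le0; apply: sin_ge0_pi.
  have p0 := @pi_gt0 R; have -> : - (2 * pi * (x - b)) = pi * (2 * (b - x)) by ring.
  by rewrite mulr_ge0 ?ger_pMr //; lra.
rewrite /sgsin /ind_gt0 le_eqVlt => /predU1P[->|/ltr0_sg ->]; last by lra.
by rewrite sgr0; lra.
Qed.

Let ind_gt01 : ind_gt0 1 = 1. Proof. by rewrite /ind_gt0; lra. Qed.

(** On $[0, 1[$ the indicator is constant when $b < 0$ or $b \ge 1$. Otherwise the complement $]b,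
    1[$ is built from open half-circles: a union of those starting at $1/2$, $b$ and an intermediate
    point if $b < 1/2$, the intersection of those starting at $1/2$ and $b$ if $b \ge 1/2$. *)
Lemma bounded_approx_ray (b : R) : bounded_approx (\1_`]-oo, b]).
Proof.
have [b0|b0] := ltP b 0.
  apply: bounded_approx_ext (indic_bounded _) (bounded_approx_cst 0) => x /=.
  rewrite in_itv /= => /andP[x0 _]; rewrite indicE memNset //= in_itv /=.
  by apply/negP; rewrite -ltNge; lra.
have [b1|b1] := leP 1 b.
  apply: bounded_approx_ext (indic_bounded _) (bounded_approx_cst 1) => x /=.
  by rewrite in_itv /= => /andP[_ x1]; rewrite indicE mem_set //= in_itv /=; lra.
have i1 : bounded_approx (fun x => ind_gt0 (sgsin (1 / 2) x)) by [].
have ib : bounded_approx (fun x => ind_gt0 (sgsin b x)) by [].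
have [bh|bh] := ltP b (1 / 2).
(* The extra half-circle starting at c covers the point 1/2 when b = 0. *)
- pose c := (b + 1 / 2) / 2.
  have ic : bounded_approx (fun x => ind_gt0 (sgsin c x)) by [].
  have i1B d := bounded_approxB (bounded_approx_cst 1) d.
  apply: bounded_approx_ext (indic_bounded _)
    (bounded_approxM (i1B _ i1) (bounded_approxM (i1B _ ib) (i1B _ ic))) => x /=.
  rewrite in_itv /= => /andP[x0 x1]; have [xb|bx] := leP x b.
    rewrite indicE mem_set /= ?in_itv //= (@sgsin_le0 (1 / 2)); last by lra.
    rewrite (@sgsin_le0 b); last by lra.
    by rewrite (@sgsin_le0 c) ?subr0 ?mulr1 // /c; lra.
  rewrite indicE memNset /= ?in_itv /=; last by apply/negP; rewrite -ltNge.
  have [xh|hx] := leP x (1 / 2); last first.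
    by rewrite (@sgsin_gt0 (1 / 2)) ?ind_gt01 ?subrr ?mul0r //; lra.
  have [xb|bx'] := ltP x (b + 1 / 2).
    by rewrite (@sgsin_gt0 b) ?ind_gt01 ?subrr ?mul0r ?mulr0 //; lra.
  by rewrite (@sgsin_gt0 c) ?ind_gt01 ?subrr ?mulr0 // /c; lra.
- apply: bounded_approx_ext (indic_bounded _)
    (bounded_approxB (bounded_approx_cst 1) (bounded_approxM i1 ib)) => x /=.
  rewrite in_itv /= => /andP[x0 x1]; have [xb|bx] := leP x b.
    rewrite indicE mem_set /= ?in_itv //=.
    have [xh|hx] := leP x (1 / 2); first by rewrite (@sgsin_le0 (1 / 2)) ?mul0r ?subr0 //; lra.
    by rewrite (@sgsin_le0 b) ?mulr0 ?subr0 //; lra.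
  rewrite indicE memNset /= ?in_itv /=; last by apply/negP; rewrite -ltNge.
  rewrite (@sgsin_gt0 (1 / 2)); last by lra.
  by rewrite (@sgsin_gt0 b) ?ind_gt01 ?mulr1 ?subrr //; lra.
Qed.

End IndicatorsAreApproximable.

(** * From indicators to all square-integrable functions *)

Section TrigonometricDensityL2.
Context (R : realType).
Implicit Types (f g : R -> R[i]) (u v : R -> R).
Local Notation T1 := (`[0 : R, 1[%classic).

Lemma bounded_approx_setU (A B : set R) :
  bounded_approx (\1_A : R -> R) -> bounded_approx (\1_B : R -> R) ->
  bounded_approx (\1_(A `|` B) : R -> R).
Proof.
move=> aA aB; have i1 := bounded_approx_cst (1 : R).
have := bounded_approxB i1 (bounded_approxM (bounded_approxB i1 aA) (bounded_approxB i1 aB)).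
congr bounded_approx; apply/funext => x; rewrite !indicE in_setU.
by case: (x \in A); case: (x \in B) => /=; ring.
Qed.

(** The sets with approximable indicator form a sigma-algebra that contains the generating half-open
    intervals. Measurability is carried along in [G] because a limit in [bounded_approx_lim] must be
    known to be measurable. *)
Lemma bounded_approx_indic (A : set R) :
  measurable A -> bounded_approx (\1_A : R -> R).
Proof.
pose G := [set A : set R | measurable A /\ bounded_approx (\1_A : R -> R)].
suff : measurable `<=` G by move=> h /h[].
have i1 := bounded_approx_cst (1 : R).
have G0 : G set0.
  split; first exact: measurable0.
  have := bounded_approx_cst (0 : R); congr bounded_approx.
  by apply/funext => x; rewrite indicE in_set0.
have GC : forall A, G A -> G (setT `\` A).
  move=> B [mB aB]; split; first exact: measurableD.
  have := bounded_approxB i1 aB; congr bounded_approx.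
  by apply/funext => x; rewrite setTD !indicE in_setC; case: (x \in B); rewrite ?subrr ?subr0.
have GU (F : nat -> set R) : (forall n, G (F n)) -> G (\bigcup_k F k).
  move=> GF.
  have mF : measurable (\bigcup_k F k) by apply: bigcup_measurable => k _; case: (GF k).
  (* Finite partial unions: at each point their indicators are eventually constant. *)
  split=> //; apply: (@bounded_approx_lim _ (fun n => \1_(\big[setU/set0]_(i < n) F i)) _ 1).
  - elim=> [|n IHn]; first by rewrite big_ord0; case: G0.
    by rewrite big_ord_recr /=; apply: bounded_approx_setU => //; case: (GF n).
  - exact: (measurable_indic mF).
  - move=> x; have [/set_mem[k _ Fkx]|xF] := boolP (x \in \bigcup_k F k).
      apply: (@cvg_near_cst _ _ _ _ \oo); near=> n; rewrite !indicE !mem_set //.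
        by exists k.
      rewrite -bigcup_mkord; exists k => //=; near: n; exact: nbhs_infty_gt.
    apply: (@cvg_near_cst _ _ _ _ \oo); apply: nearW => n.
    rewrite !indicE (negbTE xF) memNset // -bigcup_mkord => -[k _ Fkx].
    by move/negP: xF; apply; rewrite inE; exists k.
  - by move=> n x; rewrite indicE; case: (_ \in _); rewrite ?normr0 ?normr1.
apply: smallest_sub; first by split.
move=> _ [[a b] _ <-] /=.
split; first exact: measurable_itv.
have [ab|ba] := leP a b; last first.
  by rewrite set_itv_ge; [case: G0 | rewrite bnd_simp -leNgt ltW].
(* The indicator of $]a, b]$ is a difference of indicators of rays. *)
have := bounded_approxB (bounded_approx_ray b) (bounded_approx_ray a).
congr bounded_approx; apply/funext => x; rewrite !indicE !mem_setE !in_itv /=.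
have [xa|ax] := leP x a; first by rewrite (le_trans xa ab) subrr.
by rewrite subr0.
Unshelve. all: by end_near.
Qed.

Lemma bounded_approx_sum (I : Type) (s : seq I) (F : I -> R -> R) :
  (forall i, bounded_approx (F i)) -> bounded_approx (fun x => \sum_(i <- s) F i x).
Proof.
move=> aF; elim: s => [|i s IHs].
  by under eq_fun do rewrite big_nil; exact: bounded_approx_cst.
by under eq_fun do rewrite big_cons; exact: bounded_approxD.
Qed.

Import HBNNSimple.

Lemma bounded_approx_nnsfun (u : {nnsfun R >-> R}) : bounded_approx u.
Proof.
have -> : (u : R -> R) = fun x => \sum_(i < #|` fset_set (range u)|)
    ((fset_set (range u))`_i * \1_(u @^-1` [set (fset_set (range u))`_i]) x).
  by apply/funext => x; exact: fimfunEord.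
apply: bounded_approx_sum => i; apply: bounded_approxM; first exact: bounded_approx_cst.
by apply: bounded_approx_indic; exact: measurable_funPTI.
Qed.

Let mT1 : measurable T1. Proof. exact: measurable_itv. Qed.

(** The increasing simple approximations of [u] are dominated by [u] itself, whose square is
    integrable. *)
Lemma trig_approx_ge0 u : measurable_fun T1 u -> (forall x, 0 <= u x) ->
  mu.-integrable T1 (fun x => (u x ^+ 2)%:E) -> trig_approx (fun x => (u x)%:C).
Proof.
move=> mu1 u0 iu.
have mu2 : measurable_fun T1 (EFin \o u) by exact/measurable_EFinP.
pose s := nnsfun_approx mT1 mu2.
have u0E x : T1 x -> (0%:E <= (EFin \o u) x)%E by rewrite /= lee_fin.
have cvs x : T1 x -> s n x @[n --> \oo] --> u x.
  move=> Dx; have h := @cvg_nnsfun_approx _ _ _ _ mT1 _ mu2 u0E x Dx.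
  exact: (fine_cvg h).
apply: (@trig_approx_dominated _ (fun n => s n : R -> R) u u) => //.
- by move=> n; case: (bounded_approx_nnsfun (s n)).
- move=> n x Dx; rewrite ger0_norm //; have /cvg_lim <- := cvs x Dx; last exact: Rhausdorff.
  apply: (@nondecreasing_cvgn_le _ (fun n => s n x)).
    by move=> a b ab; have /lefP := nd_nnsfun_approx mT1 mu2 ab; exact.
  by apply/cvg_ex; exists (u x); exact: cvs.
Qed.

Lemma trig_approx_sqintR u : sqintR lebesgue_measure T1 u -> trig_approx (fun x => (u x)%:C).
Proof.
move=> [mu1 iu].
have le_int (w : R -> R) : measurable_fun T1 w -> (forall x, `|w x| <= `|u x|) ->
    mu.-integrable T1 (fun x => (w x ^+ 2)%:E).
  move=> mw wu; apply: (le_integrable _ _ _ iu) => //.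
    by apply/measurable_EFinP; exact: measurable_funX.
  by move=> x _; rewrite /= lee_fin !normrX lerXn2r ?nnegrE.
have ap : trig_approx (fun x => (Num.max (u x) 0)%:C).
  apply: trig_approx_ge0; first exact: measurable_maxr.
    by move=> x; rewrite le_max lexx orbT.
  apply: le_int; first exact: measurable_maxr.
  by move=> x; rewrite /Num.max; case: ifP => // _; rewrite normr0.
have an : trig_approx (fun x => (Num.max (- u x) 0)%:C).
  have mNu : measurable_fun T1 (fun x => - u x) by exact: measurableT_comp.
  apply: trig_approx_ge0; first exact: measurable_maxr.
    by move=> x; rewrite le_max lexx orbT.
  apply: le_int; first exact: measurable_maxr.
  by move=> x; rewrite /Num.max; case: ifP => // _; rewrite ?normr0 ?normrN.
have := trig_approx_lin (-1) an ap; congr trig_approx; apply/funext => x.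
rewrite mulN1r -rmorphN -rmorphD; congr (_%:C).
by rewrite /Num.max; case: ltP => h1; case: ltP => h2; lra.
Qed.

Lemma trig_approx_sqintegrable f :
  sqintegrable lebesgue_measure T1 f -> trig_approx f.
Proof.
move=> /(sqintegrableE lebesgue_measure mT1)[fr fi].
have := trig_approx_lin 'i%C (trig_approx_sqintR fi) (trig_approx_sqintR fr).
by congr trig_approx; apply/funext => x; rewrite [RHS]complexE addrC.
Qed.

End TrigonometricDensityL2.

(** * Parseval's identity *)

Section OrthonormalFamily.
Context (R : realType) (V : lmodType R[i]) (ip : {dot V for @Num.conj R[i]}).
Context (I : choiceType) (v : I -> V).
Hypothesis orth : forall i j, ip (v i) (v j) = (i == j)%:R.
Implicit Types (w : V) (s : seq I) (c : I -> R[i]).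

Let ipPl a u w z : ip (a *: u + w) z = a * ip u z + ip w z.
Proof. exact: linearPl. Qed.
Let ip0l z : ip 0 z = 0. Proof. exact: linear0l. Qed.
Let ipZl a u z : ip (a *: u) z = a * ip u z. Proof. exact: linearZl_LR. Qed.
Let ipBl u w z : ip (u - w) z = ip u z - ip w z. Proof. exact: linearBl. Qed.
Let ipZr a u z : ip z (a *: u) = a^*%C * ip z u. Proof. exact: linearZr_LR. Qed.
Let ip_suml s (F : I -> V) z : ip (\sum_(j <- s) F j) z = \sum_(j <- s) ip (F j) z.
Proof. exact: linear_sumlz. Qed.
Let ip_sumr s (F : I -> V) z : ip z (\sum_(j <- s) F j) = \sum_(j <- s) ip z (F j).
Proof. exact: linear_sumr. Qed.

Lemma ip_orthonormal_sum s c i : uniq s ->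
  ip (\sum_(j <- s) c j *: v j) (v i) = if i \in s then c i else 0.
Proof.
move=> us; rewrite ip_suml; under eq_bigr do rewrite ipZl orth.
case: ifPn => is_; last first.
  rewrite big_seq big1 // => j js; case: eqVneq => [ji|]; last by rewrite /= mulr0.
  by rewrite -ji js in is_.
rewrite (bigD1_seq i) //= eqxx mulr1 big1 ?addr0 // => j /negbTE ->.
by rewrite mulr0.
Qed.

Lemma sqnorm_orthonormal_sum s c : uniq s ->
  sqnorm ip (\sum_(j <- s) c j *: v j) = \sum_(j <- s) cabs (c j) ^+ 2.
Proof.
move=> us; rewrite /sqnorm.
have -> : ip (\sum_(j <- s) c j *: v j) (\sum_(j <- s) c j *: v j) =
    (\sum_(j <- s) cabs (c j) ^+ 2)%:C.
  rewrite ip_sumr rmorph_sum /= big_seq [RHS]big_seq; apply: eq_bigr => j js.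
  by rewrite ipZr ip_orthonormal_sum // js mulrC cabs2_prod.
by [].
Qed.

Definition orth_proj s w := \sum_(j <- s) ip w (v j) *: v j.

Lemma orth_projPl s a w w' :
  orth_proj s (a *: w + w') = a *: orth_proj s w + orth_proj s w'.
Proof.
rewrite /orth_proj scaler_sumr -big_split; apply: eq_bigr => j _.
by rewrite ipPl scalerDl scalerA.
Qed.

Let ReD (x y : R[i]) : Re (x + y) = Re x + Re y.
Proof. by case: x y => [? ?] []. Qed.

Lemma sqnorm_pythagoras s w : uniq s ->
  sqnorm ip w = sqnorm ip (w - orth_proj s w) + \sum_(j <- s) cabs (ip w (v j)) ^+ 2.
Proof.
move=> us; rewrite -(sqnorm_orthonormal_sum _ us) -/(orth_proj s w).
have o0 : ip (w - orth_proj s w) (orth_proj s w) = 0.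
  rewrite [X in ip _ X]/orth_proj ip_sumr big_seq big1 // => j js.
  by rewrite ipZr ipBl ip_orthonormal_sum // js subrr mulr0.
have E : ip w w = ip (w - orth_proj s w) (w - orth_proj s w) +
    ip (orth_proj s w) (orth_proj s w).
  by rewrite -[in LHS](subrK (orth_proj s w) w); exact: (hnormDd o0).
by rewrite /sqnorm E ReD.
Qed.

Lemma sqnorm_ge0 w : 0 <= sqnorm ip w.
Proof.
rewrite /sqnorm; have [->|w0] := eqVneq w 0; first by rewrite ip0l.
have := @neq0_dnorm_gt0 _ _ _ ip w w0.
by rewrite ltcE => /andP[_ /ltW].
Qed.

(** Best approximation: as [p] is fixed by the projection, the residual of [w] is also the residual
    of $w - p$, and a residual is no longer than its vector. *)
Lemma sqnorm_sub_proj_le s w p : uniq s -> p = orth_proj s p ->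
  sqnorm ip (w - orth_proj s w) <= sqnorm ip (w - p).
Proof.
move=> us pp.
have -> : w - orth_proj s w = (w - p) - orth_proj s (w - p).
  rewrite -scaleN1r [w - p]addrC -[in RHS](scaleN1r p) orth_projPl -pp.
  by rewrite !scaleN1r opprD opprK addrACA [- p + p]addrC subrr add0r.
rewrite (sqnorm_pythagoras (w - p) us) lerDl.
by apply: sumr_ge0 => j _; exact: sqr_ge0.
Qed.

(** One direction is Bessel's inequality for finite partial sums. For the other, being fixed by
    [orth_proj s] expresses that [p] lies in the span of [s], so the residual of [w] along [s] has
    squared norm below [e]. *)
Lemma orthonormal_parseval w :
  (forall e : R, 0 < e -> exists p (s : seq I),
     [/\ uniq s, p = orth_proj s p & sqnorm ip (w - p) < e]) ->
  (\esum_(j in [set: I]) (cabs (ip w (v j)) ^+ 2)%:E)%E = (sqnorm ip w)%:E.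
Proof.
move=> dense; apply/eqP; rewrite eq_le; apply/andP; split.
  apply: ge_ereal_sup => _ [X [finX _] <-].
  rewrite fsbig_finite //= sumEFin lee_fin.
  rewrite (sqnorm_pythagoras w (fset_uniq (fset_set X))) lerDr; exact: sqnorm_ge0.
apply/lee_addgt0Pr => e /dense[p [s [us pp we]]].
rewrite (sqnorm_pythagoras w us) EFinD addeC leeD //; last first.
  by rewrite lee_fin (le_trans (sqnorm_sub_proj_le w us pp)) // ltW.
apply: esum_ge; exists [set` s]; first by split => //; exact: finite_seq.
rewrite fsbig_finite; last exact: finite_seq.
rewrite -sumEFin /= (perm_big (finmap.enum_fset (fset_set [set` s]))) //.
apply: uniq_perm => // i; rewrite in_fset_set ?mem_setE //; exact: finite_seq.
Qed.

End OrthonormalFamily.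

(** * Norms of classes as square integrals *)

Section L2Classes.
Context (R : realType) (D : set R) (mD : measurable D).
Local Notation L2D := (L2 lebesgue_measure mD).
Local Notation ipD := (L2ip lebesgue_measure mD).

Lemma sqnorm_pi (f : L2fun lebesgue_measure mD) :
  (sqnorm ipD (\pi_L2D f))%:E = L2sq D f.
Proof.
have [mr mi i] := L2funP f.
have -> : sqnorm ipD (\pi_L2D f) = Re (L2fun_ip f f) by rewrite -L2ip_pi.
rewrite /L2fun_ip /cintegral /=.
rewrite /L2sq -[RHS]fineK; last by apply: integrable_fin_num.
congr EFin; apply: eq_Rintegral => x _; rewrite cabs2.
by case: (f x) => ? ? /=; ring.
Qed.

Lemma sqnorm_pi_sum (I : Type) (s : seq I) (c : I -> R[i])
    (E : I -> L2fun lebesgue_measure mD) :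
  (sqnorm ipD (\sum_(j <- s) c j *: \pi_L2D (E j)))%:E =
  L2sq D (fun x => \sum_(j <- s) c j * E j x)%R.
Proof.
have -> : \sum_(j <- s) c j *: \pi_L2D (E j) = \pi_L2D (\sum_(j <- s) c j *: E j).
  by rewrite raddf_sum; apply: eq_bigr => j _; exact/esym/pi_L2scale.
rewrite sqnorm_pi; congr L2sq; apply/funext => x.
elim: s => [|j s IHs]; first by rewrite !big_nil.
by rewrite !big_cons L2funPE IHs.
Qed.

Lemma L2sq_fin (f : L2fun lebesgue_measure mD) : L2sq D f \is a fin_num.
Proof. by rewrite -sqnorm_pi. Qed.

End L2Classes.

(** * The Fourier orthonormal system on $[0, 1[$ *)

Section FourierT1.
Context (R : realType).
Local Notation T1 := (`[0 : R, 1[%classic).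

Lemma expfun_mul1 (l x : R) : expfun l x = expfun 1 (l * x).
Proof. by rewrite /expfun mulr1 mulrA. Qed.

Lemma expfun_int (m : int) : expfun 1 (m%:~R : R) = 1.
Proof.
have nat_case (n : nat) : expfun 1 (n%:R : R) = 1.
  elim: n => [|n IHn]; first by rewrite /expfun mulr0 cos0 sin0.
  rewrite -natr1 expfunDr IHn mul1r /expfun !mulr1.
  by rewrite mulr_natl cos2pi sin2pi.
case: m => n; first exact: nat_case.
rewrite NegzE mulrNz.
have -> : expfun 1 (- n.+1%:~R) = (expfun 1 (n.+1%:R : R))^*%C.
  by rewrite -expfunN /expfun !mulrN !mulNr !mulr1.
by rewrite nat_case conjc1.
Qed.

Let integral_T1 (f F : R -> R) : continuous f ->
  (forall x : R, is_derive x 1 F (f x)) ->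
  \int[mu]_(x in T1) f x = F 1 - F 0.
Proof.
move=> cf dF.
have cF x : {for x, continuous F}.
  by apply: differentiable_continuous; apply/derivable1_diffP; case: (dF x).
have mf : measurable_fun T1 f.
  by apply: measurable_funTS; exact: continuous_measurable_fun.
rewrite /Rintegral integral_itv_bndo_bndc; last exact/measurable_EFinP.
rewrite (@continuous_FTC2 _ f F) //.
- exact: continuous_subspaceT.
- split.
  + by move=> x _; case: (dF x).
  + exact: cvg_at_right_filter (cF 0).
  + exact: cvg_at_left_filter (cF 1).
- by move=> x _; rewrite derive1E; exact: derive_val.
Qed.

Lemma cintegral_expfun (k : int) :
  cintegral lebesgue_measure T1 (expfun (k%:~R : R)) = (k == 0)%:R.
Proof.
have [->|k0] := eqVneq k 0.
  have -> : expfun 0%:~R = (fun=> 1) :> (R -> R[i]).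
    by apply/funext => x; rewrite expfun0.
  have I1 := @integral_T1 (cst 1) id (@cst_continuous R R (1 : R)) (fun x => is_derive_id x 1).
  have I0 := @integral_T1 (cst 0) (cst 0) (@cst_continuous R R (0 : R))
    (fun x => is_derive_cst 0 x 1).
  by rewrite /cintegral /= [X in X +i* _]I1 [X in _ +i* X]I0 !subr0.
(* The antiderivatives $\sin(cx)/c$ and $-\cos(cx)/c$ take equal values at 0 and 1, because [k] is
   an integer. *)
pose c : R := 2 * pi * k%:~R.
have c0 : c != 0 by rewrite !mulf_neq0 ?intr_eq0 // gt_eqF // pi_gt0.
have [ck sk] : cos c = 1 /\ sin c = 0.
  by have := expfun_int k; rewrite /expfun mulr1 => -[-> ->].
have ccont x : {for x, continuous (fun x => c * x)} by exact: mulrl_continuous.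
have cosc : continuous (fun x => cos (c * x)).
  by move=> x; apply: continuous_comp (ccont x) _; exact: continuous_cos.
have sinc : continuous (fun x => sin (c * x)).
  by move=> x; apply: continuous_comp (ccont x) _; exact: continuous_sin.
have dsin (x : R) : is_derive x 1 (fun x => c^-1 * sin (c * x)) (cos (c * x)).
  by apply: is_derive_eq; rewrite /GRing.scale /=; field.
have dcos (x : R) : is_derive x 1 (fun x => - c^-1 * cos (c * x)) (sin (c * x)).
  by apply: is_derive_eq; rewrite /GRing.scale /=; field.
rewrite /cintegral /= [X in X +i* _](integral_T1 cosc dsin) [X in _ +i* X](integral_T1 sinc dcos).
by rewrite !mulr1 !mulr0 ck sk sin0 cos0 !subrr.
Qed.

Let mT1 : measurable T1. Proof. exact: measurable_itv. Qed.
Let T1_fin : (lebesgue_measure T1 < +oo)%E.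
Proof. by rewrite [ltLHS]lebesgue_measure_itv /= lte01 oppr0 adde0 ltry. Qed.

Let e (n : int) : L2fun lebesgue_measure mT1 := MkL2fun (expfun_L2 mT1 n%:~R T1_fin).
Local Notation V := (L2 lebesgue_measure mT1).
Local Notation ip := (L2ip lebesgue_measure mT1).
Let v n : V := \pi_V (e n).

Let v_orth m n : ip (v m) (v n) = (m == n)%:R.
Proof.
have -> : ip (v m) (v n) = L2fun_ip (e m) (e n) by exact: L2ip_pi.
rewrite /L2fun_ip; have -> : (fun x => e m x * (e n x)^*%C) = expfun (m - n)%:~R.
  apply/funext => x; rewrite -[e m x]/(expfun m%:~R x) -[e n x]/(expfun n%:~R x).
  by rewrite -expfunN -expfunD intrB.
by rewrite cintegral_expfun subr_eq0.
Qed.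

Lemma L2sq_trig_sum (s : seq int) (c : int -> R[i]) : uniq s ->
  L2sq T1 (fun x => \sum_(n <- s) c n * expfun n%:~R x)%R =
  (\sum_(n <- s) cabs (c n) ^+ 2)%:E.
Proof.
by move=> us; rewrite -(sqnorm_orthonormal_sum v_orth c us) (sqnorm_pi_sum s c e).
Qed.

(** Quantifying over all [s] containing [s0] makes the induction pass: for a linear combination, the
    union of the two frequency sets serves both terms. *)
Let trigpoly_proj p : trigpoly p -> exists (P : L2fun lebesgue_measure mT1) (s0 : {fset int}),
  (forall x, P x = p x) /\
  forall s : {fset int}, (s0 `<=` s)%fset -> \pi_V P = orth_proj ip v s (\pi_V P).
Proof.
elim=> [n|c {}p q _ [P [sp [Pp Ps]]] _ [Q [sq [Qq Qs]]]].
  exists (e n), [fset n]%fset; split=> // s /fsubsetP ns.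
  have {}ns : n \in s by apply: ns; rewrite inE.
  rewrite /orth_proj (big_fsetD1 n) //= -/(v n) v_orth eqxx scale1r big_seq big1 ?addr0 // => m.
  by rewrite !inE => /andP[/negbTE mn _]; rewrite v_orth eq_sym mn scale0r.
exists (c *: P + Q), (sp `|` sq)%fset; split=> [x|s].
  by rewrite L2funPE Pp Qq.
rewrite fsubUset => /andP[/Ps h1 /Qs h2].
have -> : \pi_V (c *: P + Q) = c *: \pi_V P + \pi_V Q.
  by rewrite raddfD; congr (_ + _); exact: pi_L2scale.
by rewrite orth_projPl -h1 -h2.
Qed.

Theorem fourier_parseval (f : R -> R[i]) : sqintegrable lebesgue_measure T1 f ->
  (\esum_(n in [set: int])
     (cabs (cintegral lebesgue_measure T1 (fun x => f x * (expfun n%:~R x)^*%C)) ^+ 2)%:E)%E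
  = L2sq T1 f.
Proof.
move=> sf; pose F := MkL2fun (introT (L2predP lebesgue_measure mT1 f) sf).
rewrite -(sqnorm_pi F) -(orthonormal_parseval v_orth).
  apply: eq_esum => n _; congr (cabs _ ^+ 2)%:E.
  exact: (esym (L2ip_pi F (e n))).
move=> eps eps0; have [_ /(_ _ eps0)[p [_ tp] fp]] := trig_approx_sqintegrable sf.
have [P [s [Pp Ps]]] := trigpoly_proj tp.
exists (\pi_V P), s; split; [exact: fset_uniq|exact: Ps|].
rewrite -raddfB -lte_fin sqnorm_pi; congr (_ < _)%E: fp; congr L2sq.
by apply/funext => x; rewrite -Pp.
Qed.

End FourierT1.

(** * Folding the unit intervals onto [0, 1[ *)

Section Translation.
Context (R : realType).
Local Notation T1 := (`[0 : R, 1[%classic).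

Let tr (a x : measurableTypeR R) : measurableTypeR R := x + a.

Let measurable_tr a : measurable_fun setT (tr a).
Proof.
have h : measurable_fun [set: R] (fun x : R => x + a).
  by apply: measurable_funD => //; exact: measurable_cst.
exact: h.
Qed.

(** Lebesgue measure is determined by its values on half-open intervals, and translation preserves
    their length. *)
Let lebesgue_tr a (A : set (measurableTypeR R)) : measurable A ->
  lebesgue_measure A = pushforward lebesgue_measure (tr a) A.
Proof.
move=> mA.
pose nu : {measure set (measurableTypeR R) -> \bar R} :=
  measure_function_pushforward__canonical__measure_function_Measure
    lebesgue_measure (measurable_tr a).
apply: (@lebesgue_measure_unique R nu) => // X [[b c] _ <-] /=.
rewrite /nu /= /pushforward.
have -> : tr a @^-1` `]b, c] = `]b - a, c - a]%classic.
  by apply/seteqP; split=> x; rewrite /= !in_itv /= /tr ltrBlDr lerBrDr.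
rewrite [LHS]lebesgue_measure_itv [RHS]lebesgue_measure_itv /= !lte_fin ltrD2r.
by case: ifP => // _; rewrite -!EFinB; congr EFin; ring.
Qed.

Lemma ge0_integral_translate (a : R) (D : set (measurableTypeR R))
    (f : measurableTypeR R -> \bar R) :
  measurable D -> measurable_fun D f -> (forall y, D y -> (0 <= f y)%E) ->
  (\int[lebesgue_measure]_(y in D) f y =
   \int[lebesgue_measure]_(x in [set x | D (x + a)%R]) f (x + a)%R)%E.
Proof.
move=> mD mf f0.
pose nu : {measure set (measurableTypeR R) -> \bar R} :=
  measure_function_pushforward__canonical__measure_function_Measure
    lebesgue_measure (measurable_tr a).
transitivity (\int[nu]_(y in D) f y)%E.
  by apply: eq_measure_integral => A mA _; exact: lebesgue_tr.
by apply: (ge0_integral_pushforward (measurable_tr a)) => // y; rewrite inE => /f0.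
Qed.

Let preimage_unit_itv (c : R) : [set x : measurableTypeR R | `[c, c + 1[%classic (x + c)%R] = T1.
Proof.
by apply/seteqP; split=> x /=; rewrite !in_itv /= lerDr (addrC c 1) ltrD2r.
Qed.

Let mT1 : measurable T1. Proof. exact: measurable_itv. Qed.

Lemma ge0_integral_unit_itv (c : R) (f : R -> \bar R) :
  measurable_fun `[c, c + 1[%classic f ->
  (forall y, `[c, c + 1[%classic y -> (0 <= f y)%E) ->
  (\int[mu]_(y in `[c, (c + 1)%R[) f y = \int[mu]_(x in T1) f (x + c)%R)%E.
Proof.
by move=> mf f0; rewrite (ge0_integral_translate c) ?preimage_unit_itv.
Qed.

Lemma measurable_fun_translate d (S : sigmaRingType d) (c : R) (f : R -> S) :
  measurable_fun `[c, c + 1[%classic f -> measurable_fun T1 (fun x => f (x + c)).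
Proof.
move=> mf; apply: (measurable_comp (F := `[c, c + 1[%classic)) mf _ => //.
- by move=> _ [x + <-] /=; rewrite !in_itv /= lerDr (addrC c 1) ltrD2r.
- by apply: measurable_funD => //; exact: measurable_cst.
Qed.

Lemma integrable_translate (c : R) (u : R -> R) :
  mu.-integrable `[c, c + 1[%classic (EFin \o u) ->
  mu.-integrable T1 (EFin \o (fun x => u (x + c))).
Proof.
move=> /integrableP[mu1 iu]; apply/integrableP; split.
  exact: (measurable_fun_translate mu1).
move: iu; rewrite ge0_integral_unit_itv //; exact: measurableT_comp.
Qed.

Lemma Rintegral_unit_itv (c : R) (u : R -> R) :
  measurable_fun `[c, c + 1[%classic (EFin \o u) ->
  \int[mu]_(y in `[c, c + 1[) u y = \int[mu]_(x in T1) u (x + c).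
Proof.
move=> mu1; rewrite /Rintegral; congr fine.
have mp : measurable_fun `[c, c + 1[%classic ((EFin \o u)^\+)%E by exact/measurable_funepos.
have mn : measurable_fun `[c, c + 1[%classic ((EFin \o u)^\-)%E by exact/measurable_funeneg.
have ep := ge0_integral_unit_itv mp (fun y _ => funepos_ge0 (EFin \o u) y).
have en := ge0_integral_unit_itv mn (fun y _ => funeneg_ge0 (EFin \o u) y).
rewrite integralE [RHS]integralE; congr (_ - _)%E.
- by rewrite [LHS]ep; apply: eq_integral => x _; rewrite !funeposE.
- by rewrite [LHS]en; apply: eq_integral => x _; rewrite !funenegE.
Qed.

End Translation.

(** * Decomposition of integrals over the disjoint unit intervals *)

Section UnitIntervals.
Context (R : realType) (M : nat) (a : nat -> int).
Hypothesis a_inj : forall i j : 'I_M, a i = a j -> i = j.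
Local Notation T1 := (`[0 : R, 1[%classic).
Local Notation U := (unit_intervals R M a).
Let itv (k : 'I_M) : set R := `[(a k)%:~R, (a k)%:~R + 1[%classic.

Let mU : measurable U. Proof. exact: measurable_unit_intervals. Qed.

Let U_bigsetU : U = \big[setU/set0]_(k < M) itv k.
Proof. exact: bigcup_mkord. Qed.

Let itv_sub k : itv k `<=` U.
Proof. by move=> x kx; exists (k : nat) => //=. Qed.

Let triv_itv : trivIset [set` index_enum 'I_M] itv.
Proof.
apply/trivIsetP => /= i j _ _; apply: contraNeq => /set0P[x []].
rewrite /itv /= !in_itv /= => /andP[ix xi] /andP[jx xj].
(* A common point $x$ gives $a_i \le x < a_j + 1$, hence $a_i \le a_j$ by integrality, and
   symmetrically; injectivity of [a] then yields $i = j$. *)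
have step (m n : int) : (m%:~R : R) <= x -> x < n%:~R + 1 -> m <= n.
  move=> mx xn; rewrite -ltzD1 -(ltr_int R) intrD; exact: le_lt_trans xn.
by apply/eqP/a_inj/eqP; rewrite eq_le !step.
Qed.

Lemma ge0_integral_unit_intervals (f : R -> \bar R) :
  measurable_fun U f -> (forall x, U x -> (0 <= f x)%E) ->
  (\int[mu]_(x in U) f x =
   \sum_(k < M) \int[mu]_(x in T1) f (x + (a k)%:~R)%R)%E.
Proof.
rewrite U_bigsetU => mf f0.
have mitv k : measurable (itv k) by exact: measurable_itv.
apply: etrans (ge0_integral_bigsetU mu mitv (index_enum_uniq _) triv_itv mf f0) _.
apply: eq_bigr => k _; rewrite ge0_integral_unit_itv //.
- apply: measurable_funS mf; last by rewrite -U_bigsetU; exact: itv_sub.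
  by rewrite -U_bigsetU.
- by move=> y ky; apply: f0; rewrite -U_bigsetU; exact: (@itv_sub k).
Qed.

Lemma Rintegral_unit_intervals (u : R -> R) : mu.-integrable U (EFin \o u) ->
  \int[mu]_(x in U) u x = \sum_(k < M) \int[mu]_(x in T1) u (x + (a k)%:~R).
Proof.
move=> iu; have mf := measurable_int _ iu.
have iuk k : mu.-integrable (itv k) (EFin \o u).
  by apply: integrableS iu; [exact: mU|exact: measurable_itv|exact: itv_sub].
transitivity (\sum_(k < M) \int[mu]_(x in itv k) u x).
  rewrite /Rintegral sum_fine; last first.
    by move=> k _; apply: integrable_fin_num (iuk k); exact: measurable_itv.
  congr fine; move: mf; rewrite U_bigsetU => mf.
  have mitv k : measurable (itv k) by exact: measurable_itv.
  exact: (integral_bigsetU_EFin mu mitv (index_enum_uniq _) triv_itv mf).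
apply: eq_bigr => k _; rewrite Rintegral_unit_itv //.
by have := measurable_int _ (iuk k).
Qed.

Lemma integrable_unit_intervals (u : R -> R) (k : 'I_M) : mu.-integrable U (EFin \o u) ->
  mu.-integrable T1 (EFin \o (fun x => u (x + (a k)%:~R))).
Proof.
move=> iu; apply: integrable_translate.
by apply: integrableS iu; [exact: mU|exact: measurable_itv|exact: itv_sub].
Qed.

Lemma measurable_unit_intervals_translate (u : R -> R) (k : 'I_M) :
  measurable_fun U u -> measurable_fun T1 (fun x => u (x + (a k)%:~R)).
Proof.
move=> mu1; apply: measurable_fun_translate.
by apply: measurable_funS mu1 => //; exact: itv_sub.
Qed.

End UnitIntervals.

(** * The Vandermonde matrix *)

Section MatrixBounds.
Context (R : realType) (n : nat).
Implicit Types (W : 'M[R[i]]_n) (v : 'I_n -> R[i]).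

Lemma mx_cabs2_le W : exists2 C : R, 0 < C & forall v,
  \sum_i cabs (\sum_k W i k * v k) ^+ 2 <= C * \sum_k cabs (v k) ^+ 2.
Proof.
pose S i := \sum_k cabs (W i k) ^+ 2.
have S0 i : 0 <= S i by apply: sumr_ge0 => k _; exact: sqr_ge0.
(* The factor [n] comes from [cabs2_sum]; the final 1 keeps the constant positive even when all
   entries vanish. *)
exists (n%:R * (\sum_i S i) + 1) => [|v].
  by rewrite ltr_wpDl // mulr_ge0 // sumr_ge0.
have v0 : 0 <= \sum_k cabs (v k) ^+ 2 by apply: sumr_ge0 => k _; exact: sqr_ge0.
rewrite mulrDl mul1r -[leLHS]addr0 lerD // -mulrA mulr_suml mulr_sumr.
apply: ler_sum => i _; apply: le_trans (cabs2_sum _) _; rewrite card_ord ler_wpM2l //.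
rewrite /S mulr_suml; apply: ler_sum => k _; rewrite cabs2M ler_wpM2l ?sqr_ge0 //.
by rewrite (bigD1 k) //= lerDl; apply: sumr_ge0 => j _; exact: sqr_ge0.
Qed.

(** The upper bound for the inverse matrix, applied to the vector $W v$. *)
Lemma unitmx_cabs2_ge W : W \in unitmx -> exists2 C : R, 0 < C & forall v,
  \sum_k cabs (v k) ^+ 2 <= C * \sum_i cabs (\sum_k W i k * v k) ^+ 2.
Proof.
move=> uW; have [C C0 CP] := mx_cabs2_le (invmx W); exists C => // v.
apply: le_trans (CP _); rewrite le_eqVlt; apply/orP; left; apply/eqP.
apply: eq_bigr => i _; congr (cabs _ ^+ 2).
pose V : 'cV[R[i]]_n := \col_k v k.
have -> : v i = (invmx W *m (W *m V)) i 0 by rewrite mulKmx // mxE.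
rewrite mxE; apply: eq_bigr => k _; congr (_ * _); rewrite mxE.
by apply: eq_bigr => l _; rewrite mxE.
Qed.

Lemma Vandermonde_unitmx (w : 'I_n -> R[i]) : injective w ->
  Vandermonde n (\row_k w k) \in unitmx.
Proof.
move=> w_inj; rewrite unitmxE det_Vandermonde unitfE prodf_seq_neq0.
apply/allP => i _ /=; rewrite prodf_seq_neq0; apply/allP => j _; apply/implyP => ij.
by rewrite !mxE subr_eq0 (inj_eq w_inj) gt_eqF.
Qed.

End MatrixBounds.

(** * Injectivity and powers of the exponential *)

Section UnitCircle.
Context (R : realType).

(** With $d = x - y$, $\cos(2 \pi d) = 1$ forces $\sin(\pi d) = 0$, which is impossible for $0 < |d|
    < 1$. *)
Lemma expfun1_inj (x y : R) : `|x - y| < 1 -> expfun 1 x = expfun 1 y -> x = y.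
Proof.
move=> d1 exy; apply/eqP; rewrite -subr_eq0; apply/eqP.
have : expfun 1 (x - y) = 1.
  by rewrite expfunDr exy -expfunDr subrr /expfun mulr0 cos0 sin0.
move: (x - y) d1 => d d1 [cd _].
have sd : sin (pi * d) = 0.
  have : cos ((pi * d) *+ 2) = 1 by rewrite -cd mulr1 -mulrA mulr_natl.
  rewrite cos_mulr2n cos2sin2 => h; apply/eqP; rewrite -sqrf_eq0; apply/eqP; move: h.
  by rewrite mulr2n; move: (sin _ ^+ 2) => s; lra.
have p0 := @pi_gt0 R; have [d0|d0|//] := ltgtP d 0.
- have := @sin_gt0_pi R (pi * - d); rewrite mulrN sinN sd oppr0 ltxx -mulrN.
  move: d1; rewrite ltr0_norm // => d1.
  have -> : (0 < pi * - d < pi) by rewrite mulr_gt0 ?gtr_pMr //; lra.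
  by move=> /(_ isT).
- have := @sin_gt0_pi R (pi * d); rewrite sd ltxx.
  move: d1; rewrite gtr0_norm // => d1.
  have -> : (0 < pi * d < pi) by rewrite mulr_gt0 ?gtr_pMr //; lra.
  by move=> /(_ isT).
Qed.

Lemma expfun1_expn (x : R) (j : nat) : expfun 1 x ^+ j = expfun 1 (j%:R * x).
Proof.
elim: j => [|j IHj]; first by rewrite expr0 mul0r /expfun mulr0 cos0 sin0.
by rewrite exprSr IHj -expfunDr -natr1 mulrDl mul1r.
Qed.

End UnitCircle.

(** * Sums over pairs of indices *)

Section SumsOverIndices.
Context (R : realType).

Lemma esum_finType_prod (I : finType) (T : choiceType) (F : I * T -> \bar R) :
  (forall p, (0 <= F p)%E) ->
  (\esum_(p in [set: I * T]) F p = \sum_(i : I) \esum_(n in [set: T]) F (i, n))%E.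
Proof.
move=> F0; have -> : [set: I * T] = [set: I] `*`` (fun=> [set: T]).
  by apply/seteqP; split.
rewrite (eq_esum (b := fun p => F (p.1, p.2))) => [|[]//].
rewrite -(esum_esum (a := fun i n => F (i, n))) => [|i n _ _]; last exact: F0.
rewrite esum_fset => [||i _]; [|exact: finite_finset|exact: esum_ge0].
rewrite fsbig_finite; last exact: finite_finset.
apply: perm_big; apply: uniq_perm; [exact: fset_uniq|exact: index_enum_uniq|] => i.
by rewrite in_fset_set ?in_setT ?mem_index_enum //; exact: finite_finset.
Qed.

(** Padding with zeros extends [J] to a rectangle, so that every [i] gets the same set [K] of second
    indices. *)
Lemma big_fset_prod (I : finType) (T : choiceType) (V : nmodType)
    (J : {fset I * T}) (K := [fset p.2 | p in J]%fset) (F : I * T -> V) :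
  \sum_(p <- J) F p = \sum_i \sum_(n <- K) (if (i, n) \in J then F (i, n) else 0).
Proof.
rewrite -(big_allpairs (r1 := index_enum I) (r2 := K)
  (F := fun p => if p \in J then F p else 0)) -big_mkcond -big_filter.
apply: perm_big; apply: uniq_perm; first exact: fset_uniq.
  rewrite filter_uniq //; apply: allpairs_uniq; [exact: index_enum_uniq|exact: fset_uniq|].
  by move=> [? ?] [? ?] _ _.
move=> [i n]; rewrite mem_filter; case: (boolP ((i, n) \in J)) => //= iJ.
apply/esym/allpairsP; exists (i, n); split=> //=; first exact: mem_index_enum.
by apply/imfsetP; exists (i, n).
Qed.

End SumsOverIndices.

(** * Integrated inequalities between sums of squares *)

Section L2sqSums.
Context (R : realType) (D : set R) (mD : measurable D).

(** Transfers the pointwise matrix bounds to square integrals. *)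
Lemma le_sum_L2sq (I J : finType) (F : I -> R -> R[i]) (G : J -> R -> R[i]) (C : R) :
  0 <= C -> (forall i, cmeasurable D (F i)) -> (forall j, cmeasurable D (G j)) ->
  (forall x, \sum_i cabs (F i x) ^+ 2 <= C * \sum_j cabs (G j x) ^+ 2) ->
  (\sum_i L2sq D (F i) <= C%:E * \sum_j L2sq D (G j))%E.
Proof.
move=> C0 mF mG FG.
have mE (f : R -> R[i]) : cmeasurable D f -> measurable_fun D (fun x => (cabs (f x) ^+ 2)%:E).
  by move=> mf; apply/measurable_EFinP; exact: measurable_cabs2.
have ge0 (f : R -> R[i]) x : D x -> (0%R <= (cabs (f x) ^+ 2)%:E)%E.
  by rewrite lee_fin sqr_ge0.
have sum_eq (K : finType) (H : K -> R -> R[i]) : (forall k, cmeasurable D (H k)) ->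
    (\sum_k L2sq D (H k) = \int[mu]_(x in D) (\sum_k cabs (H k x) ^+ 2)%:E)%E.
  move=> mH; rewrite /L2sq -ge0_integral_sum //.
  - by apply: eq_integral => x _; rewrite sumEFin.
  - by move=> k; exact: mE.
  - by move=> k x Dx; exact: ge0.
have mS (K : finType) (H : K -> R -> R[i]) : (forall k, cmeasurable D (H k)) ->
    measurable_fun D (fun x => (\sum_k cabs (H k x) ^+ 2)%:E).
  move=> mH; apply/measurable_EFinP; apply: measurable_sum => k; exact: measurable_cabs2.
rewrite !sum_eq // -ge0_integralZl //.
- apply: ge0_le_integral => //.
  + by move=> x _; rewrite lee_fin sumr_ge0 // => i _; exact: sqr_ge0.
  + exact: mS.
  + apply/measurable_EFinP; apply: measurable_funM => //.
    by apply: measurable_sum => k; exact: measurable_cabs2.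
  + by move=> x _; rewrite -EFinM lee_fin.
- exact: mS.
- by move=> x _; rewrite lee_fin sumr_ge0 // => i _; exact: sqr_ge0.
Qed.

Lemma sqintegrable_L2sq (f : R -> R[i]) : cmeasurable D f -> (L2sq D f < +oo)%E ->
  sqintegrable lebesgue_measure D f.
Proof.
move=> mf fin; have [m1 m2] := mf; split=> //; apply/integrableP; split.
  by apply/measurable_EFinP; exact: (measurable_cabs2 mf).
apply: le_lt_trans fin; rewrite le_eqVlt; apply/orP; left; apply/eqP.
by apply: eq_integral => x _; rewrite gee0_abs // lee_fin sqr_ge0.
Qed.

End L2sqSums.

Section ComplexIntegralUnitIntervals.
Context (R : realType) (M : nat) (a : nat -> int).
Hypothesis a_inj : forall i j : 'I_M, a i = a j -> i = j.
Local Notation T1 := (`[0 : R, 1[%classic).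
Local Notation U := (unit_intervals R M a).

Lemma Rintegral_sum_ord (n : nat) (u : 'I_n -> R -> R) :
  (forall k, mu.-integrable T1 (EFin \o u k)) ->
  \int[mu]_(x in T1) (\sum_k u k x) = \sum_k \int[mu]_(x in T1) u k x.
Proof.
move=> iu; have mT1 : measurable T1 by exact: measurable_itv.
suff H (s : seq 'I_n) : mu.-integrable T1 (EFin \o (fun x => \sum_(k <- s) u k x)) /\
  \int[mu]_(x in T1) (\sum_(k <- s) u k x) = \sum_(k <- s) \int[mu]_(x in T1) u k x.
  by case: (H (index_enum _)).
elim: s => [|k s [IH1 IH2]].
  have -> : (fun x => \sum_(k <- [::]) u k x) = cst 0 by apply/funext => x; rewrite big_nil.
  split; first exact: integrable0.
  by rewrite big_nil /Rintegral integral0.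
have -> : (fun x => \sum_(l <- k :: s) u l x) = (fun x => u k x + \sum_(l <- s) u l x).
  by apply/funext => x; rewrite big_cons.
split; first exact: (integrableD _ (iu k) IH1).
by rewrite big_cons RintegralD // IH2.
Qed.

Lemma cintegral_unit_intervals (h : R -> R[i]) :
  mu.-integrable U (EFin \o (Re \o h)) -> mu.-integrable U (EFin \o (Im \o h)) ->
  cintegral lebesgue_measure U h =
  cintegral lebesgue_measure T1 (fun t => \sum_(k < M) h (t + (a k)%:~R)).
Proof.
move=> ire iim; rewrite /cintegral; congr Complex.
- rewrite (Rintegral_unit_intervals a_inj ire) -Rintegral_sum_ord.
    by apply: eq_Rintegral => x _; rewrite Re_sum.
  by move=> k; exact: (integrable_unit_intervals k ire).
- rewrite (Rintegral_unit_intervals a_inj iim) -Rintegral_sum_ord.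
    by apply: eq_Rintegral => x _; rewrite Im_sum.
  by move=> k; exact: (integrable_unit_intervals k iim).
Qed.

Lemma cmeasurable_unit_intervals (f : R -> R[i]) (k : 'I_M) :
  cmeasurable U f -> cmeasurable T1 (fun t => f (t + (a k)%:~R)).
Proof.
by move=> [mr mi]; split;
  [exact: (measurable_unit_intervals_translate k mr)|
   exact: (measurable_unit_intervals_translate k mi)].
Qed.

Lemma L2sq_unit_intervals (f : R -> R[i]) : cmeasurable U f ->
  L2sq U f = (\sum_(k < M) L2sq T1 (fun t => f (t + (a k)%:~R)%R))%E.
Proof.
move=> mf; apply: (ge0_integral_unit_intervals a_inj (f := fun x => (cabs (f x) ^+ 2)%:E)).
  by apply/measurable_EFinP; exact: (measurable_cabs2 mf).
by move=> x _; rewrite lee_fin sqr_ge0.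
Qed.

End ComplexIntegralUnitIntervals.

(** * Frame and Riesz sequence bounds for the exponentials *)

Section ExponentialSystem.
Context (R : realType) (M N : nat) (a : nat -> int).
Hypothesis N_gt0 : (0 < N)%N.
Hypothesis a_inj : forall i j : 'I_M, a i = a j -> i = j.
Hypothesis a_dist : forall i j : 'I_M, `|a i - a j| < N%:Z.
Local Notation T1 := (`[0 : R, 1[%classic).
Local Notation U := (unit_intervals R M a).
Local Notation mU := (measurable_unit_intervals R M a).
Local Notation L2U := (L2 lebesgue_measure mU).
Local Notation ipU := (L2ip lebesgue_measure mU).
Local Notation freq := (fun jn : 'I_M * int => jn.2%:~R + jn.1%:R / N%:R : R).
Local Notation e := (fun jn : 'I_M * int => expL2 M a (freq jn)).

Let mT1 : measurable T1. Proof. exact: measurable_itv. Qed.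

Let z (k : 'I_M) : R[i] := expfun 1 (- ((a k)%:~R / N%:R) : R).

(** Dividing $|a_i - a_j| < N$ by $N$ puts the two arguments at distance less than 1, where
    [expfun1_inj] applies. *)
Let z_inj : injective z.
Proof.
move=> i j /expfun1_inj zij; apply/a_inj/eqP; rewrite -(eqr_int R).
have NV : N%:R^-1 != 0 :> R by rewrite invr_eq0 pnatr_eq0 -lt0n.
rewrite -(inj_eq (mulIf NV)) -eqr_opp; apply/eqP/zij.
rewrite opprK addrC -mulrBl -intrB normrM normfV (gtr0_norm (x := N%:R)) ?ltr0n //.
rewrite ltr_pdivrMr ?ltr0n // mul1r -intr_norm -[N%:R]/((N%:Z)%:~R) ltr_int.
exact: a_dist.
Qed.

(** The factor $e^{2 \pi i n a_k}$ is 1, so the interval index [k] enters only through the node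
    [z k], independently of [n]. *)
Let expfun_split (j : 'I_M) (n : int) (k : 'I_M) (t : R) :
  expfun (freq (j, n)) (t + (a k)%:~R) =
  expfun n%:~R t * (expfun (j%:R / N%:R) t * (z k ^+ j)^*%C).
Proof.
rewrite /= expfunDr expfunD -mulrA; congr (_ * (_ * _)).
rewrite expfun_mul1 mulrDl -intrM expfunDr expfun_int mul1r expfun1_expn -expfunN.
rewrite /expfun mulrN !mulr1 mulrN mulNr mulrN opprK.
by rewrite -[j%:R / N%:R * _]mulrA [N%:R^-1 * _]mulrC.
Qed.

Let W : 'M[R[i]]_M := Vandermonde M (\row_k z k).
(** The conjugate transpose of [W], written as a transposed Vandermonde matrix so that the same
    invertibility criterion applies. *)
Let W' : 'M[R[i]]_M := (Vandermonde M (\row_k (z k)^*%C))^T.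

Let W_unit : W \in unitmx. Proof. exact: Vandermonde_unitmx. Qed.
Let W'_unit : W' \in unitmx.
Proof.
rewrite unitmx_tr; apply: Vandermonde_unitmx => i j /(congr1 (@conjc R)).
by rewrite !conjcK; exact: z_inj.
Qed.

Let zak (f : R -> R[i]) (k : 'I_M) (t : R) : R[i] := f (t + (a k)%:~R).

Let G (f : R -> R[i]) (j : 'I_M) (t : R) : R[i] :=
  (expfun (j%:R / N%:R) t)^*%C * \sum_k W j k * zak f k t.

(* [G f j] is the function on [0, 1[ whose n-th Fourier coefficient is the inner
   product of f with the exponential of frequency n + j/N. *)
Let cabs_G f j t : cabs (G f j t) ^+ 2 = cabs (\sum_k W j k * zak f k t) ^+ 2.
Proof. by rewrite /G cabs2M cabs_conjc cabs_expfun expr1n mul1r. Qed.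

Let cmeasurable_G f j : cmeasurable U f -> cmeasurable T1 (G f j).
Proof.
move=> mf; apply: cmeasurableM.
  exact/cmeasurable_conj/cmeasurable_expfun.
apply: cmeasurable_sum => k; apply: cmeasurableM; first exact: cmeasurable_cst.
exact: (cmeasurable_unit_intervals k mf).
Qed.

Let cmeasurable_L2 (f : L2fun lebesgue_measure mU) : cmeasurable U f.
Proof. by have [] := L2funP f. Qed.

(** For fixed [j], the sum over [n] is Parseval's identity for [G f j]. *)
Let esum_frame (f : L2fun lebesgue_measure mU) :
  (\esum_(jn in [set: 'I_M * int]) (cabs (ipU (\pi_L2U f) (e jn)) ^+ 2)%:E)%E =
  (\sum_j L2sq T1 (G f j))%E.
Proof.
have mf := cmeasurable_L2 f.
(* Here the matrix bound serves to make each [G f j] square-integrable, as [fourier_parseval]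
   requires. *)
have [C C0 CP] := mx_cabs2_le W.
have G_le := @le_sum_L2sq _ _ mT1 _ _ (G f) (zak f) C (ltW C0)
  (fun j => cmeasurable_G j mf) (fun k => cmeasurable_unit_intervals k mf).
have {}G_le : (\sum_j L2sq T1 (G f j) <= C%:E * L2sq U f)%E.
  rewrite (L2sq_unit_intervals a_inj mf); apply: G_le => x.
  by rewrite (eq_bigr _ (fun j _ => cabs_G f j x)); exact: CP.
rewrite esum_finType_prod => [|jn]; last by rewrite lee_fin sqr_ge0.
apply: eq_bigr => j _; rewrite -fourier_parseval; last first.
  apply: sqintegrable_L2sq => //; first exact: cmeasurable_G.
  have : (C%:E * L2sq U f < +oo)%E by rewrite -(fineK (L2sq_fin f)) -EFinM ltry.
  apply: le_lt_trans; apply: le_trans G_le.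
  rewrite (bigD1 j) //= leeDl //; apply: sume_ge0 => i _; apply: integral_ge0 => x _.
  by rewrite lee_fin sqr_ge0.
apply: eq_esum => n _; congr (cabs _ ^+ 2)%:E.
pose E : L2fun lebesgue_measure mU := MkL2fun (expfun_L2 mU (freq (j, n))
  (unit_intervals_lty R M a)).
rewrite [LHS](L2ip_pi f E) /L2fun_ip cintegral_unit_intervals //; last 2 first.
- by have [] := L2fun_mul_integrable f E.
- by have [] := L2fun_mul_integrable f E.
congr cintegral; apply/funext => t.
rewrite /G mulrAC mulr_sumr; apply: eq_bigr => k _.
rewrite -[E _]/(expfun (freq (j, n)) (t + (a k)%:~R)) expfun_split.
by rewrite !rmorphM /= conjcK /W !mxE /zak; ring.
Qed.

Lemma exponential_frame : exists A B : R, [/\ 0 < A, 0 < B &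
  forall w : L2U, (A%:E * (sqnorm ipU w)%:E <=
    \esum_(jn in [set: 'I_M * int]) (cabs (ipU w (e jn)) ^+ 2)%:E <=
    B%:E * (sqnorm ipU w)%:E)%E].
Proof.
have [B B0 BP] := mx_cabs2_le W; have [C C0 CP] := unitmx_cabs2_ge W_unit.
(* Since $|v|^2 \le C |W v|^2$, the lower frame constant is $1/C$. *)
exists C^-1, B; split=> //; first by rewrite invr_gt0.
elim/L2ind => f; have mf := cmeasurable_L2 f.
have mG j : cmeasurable T1 (G f j) by exact: cmeasurable_G.
have mz k : cmeasurable T1 (zak f k) by exact: (cmeasurable_unit_intervals k mf).
rewrite esum_frame sqnorm_pi (L2sq_unit_intervals a_inj mf); apply/andP; split.
  rewrite lee_pdivrMl //; apply: le_sum_L2sq => //; first exact: ltW.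
  by move=> x; rewrite [in leRHS](eq_bigr _ (fun j _ => cabs_G f j x)); exact: CP.
apply: le_sum_L2sq => //; first exact: ltW.
by move=> x; rewrite (eq_bigr _ (fun j _ => cabs_G f j x)); exact: BP.
Qed.

(** The matrix [W'] maps the vector of the [H j] to the translates of the combination [S] on the
    unit intervals, while the norms of the [H j] give exactly the sum of squared coefficients. *)
Lemma exponential_riesz_sequence : exists A B : R, [/\ 0 < A, 0 < B &
  forall (J : {fset 'I_M * int}) (c : 'I_M * int -> R[i]),
    A * (\sum_(p <- J) cabs (c p) ^+ 2)
      <= sqnorm ipU (\sum_(p <- J) c p *: e p)
      <= B * (\sum_(p <- J) cabs (c p) ^+ 2)].
Proof.
have [B B0 BP] := mx_cabs2_le W'; have [C C0 CP] := unitmx_cabs2_ge W'_unit.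
exists C^-1, B; split=> //; first by rewrite invr_gt0.
move=> J c; pose K := [fset p.2 | p in J]%fset.
(* Zero padding, so that all [j] share the frequency set [K]. *)
pose c' j n := if (j, n) \in J then c (j, n) else 0.
(* The unimodular factor carries the fractional frequency $j/N$ and leaves the modulus unchanged;
   [L2sq_trig_sum] then evaluates the norm. *)
pose H (j : 'I_M) (t : R) := expfun (j%:R / N%:R) t * \sum_(n <- K) c' j n * expfun n%:~R t.
pose S (x : R) := \sum_(p <- J) c p * expfun (freq p) x.
have mS : cmeasurable U S.
  apply: cmeasurable_sum => p; apply: cmeasurableM; first exact: cmeasurable_cst.
  exact: cmeasurable_expfun.
have mz k : cmeasurable T1 (zak S k) by exact: (cmeasurable_unit_intervals k mS).
have mH j : cmeasurable T1 (H j).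
  apply: cmeasurableM; first exact: cmeasurable_expfun.
  apply: cmeasurable_sum => n; apply: cmeasurableM; first exact: cmeasurable_cst.
  exact: cmeasurable_expfun.
have zakS k t : zak S k t = \sum_j W' k j * H j t.
  rewrite /zak /S big_fset_prod; apply: eq_bigr => j _.
  rewrite /H !mulr_sumr; apply: eq_bigr => n _; rewrite /c'; case: ifP => _.
    by rewrite expfun_split /W' !mxE rmorphXn /=; ring.
  by rewrite mul0r !mulr0.
have normS : (sqnorm ipU (\sum_(p <- J) c p *: e p))%:E = (\sum_k L2sq T1 (zak S k))%E.
  rewrite (sqnorm_pi_sum J c (fun p : 'I_M * int => MkL2fun (expfun_L2 mU (freq p)
    (unit_intervals_lty _ _ _)))).
  exact: (L2sq_unit_intervals a_inj mS).
have normH : (\sum_j L2sq T1 (H j))%E = (\sum_(p <- J) cabs (c p) ^+ 2)%:E.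
  rewrite big_fset_prod -sumEFin; apply: eq_bigr => j _.
  transitivity (L2sq T1 (fun t => \sum_(n <- K) c' j n * expfun n%:~R t)%R).
    by apply: eq_integral => t _; rewrite cabs2M cabs_expfun expr1n mul1r.
  rewrite L2sq_trig_sum ?fset_uniq //; congr EFin; apply: eq_bigr => n _.
  by rewrite /c'; case: ifP => // _; rewrite Normc.normc0 expr0n.
rewrite -2!lee_fin 2!EFinM normS -normH; apply/andP; split.
  rewrite lee_pdivrMl //; apply: le_sum_L2sq => //; first exact: ltW.
  move=> x; rewrite [in leRHS](eq_bigr (fun k => cabs (\sum_j W' k j * H j x) ^+ 2)).
    exact: CP.
  by move=> k _; rewrite zakS.
apply: le_sum_L2sq => //; first exact: ltW.
move=> x; rewrite (eq_bigr (fun k => cabs (\sum_j W' k j * H j x) ^+ 2)).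
  exact: BP.
by move=> k _; rewrite zakS.
Qed.

End ExponentialSystem.

(** The index [jn.1] runs from 0 to $M - 1$ and so plays the part of $j - 1$ in the informal
    statement. *)
Theorem proposition4p3 (R : realType) (M N : nat) (a : nat -> int)
    (M_gt0 : (0 < M)%N) (lt_MN : (M < N)%N)
    (a0 : a 0%N = 0)
    (a_lt : forall k : nat, (k.+1 < M)%N -> a k < a k.+1)
    (a_le : a M.-1 <= N%:Z - 1) :
  riesz_basis (L2ip lebesgue_measure (measurable_unit_intervals R M a))
    (fun jn : 'I_M * int => expL2 M a (jn.2%:~R + jn.1%:R / N%:R)).
Proof.
have N_gt0 : (0 < N)%N by exact: leq_ltn_trans lt_MN.
have a_homo i j : (i < j)%N -> (j < M)%N -> a i < a j.
  elim: j => // j IHj; rewrite ltnS leq_eqVlt => /predU1P[->|ij] jM; first exact: a_lt.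
  exact: lt_trans (IHj ij (ltnW jM)) (a_lt _ jM).
have a_inj (i j : 'I_M) : a i = a j -> i = j.
  move=> aij; apply/val_inj; have [ij|ji|//] := ltngtP i j.
  - by have := a_homo _ _ ij (ltn_ord j); rewrite aij ltxx.
  - by have := a_homo _ _ ji (ltn_ord i); rewrite aij ltxx.
have a_ge0 (i : 'I_M) : 0 <= a i.
  have [->|i0] := posnP i; first by rewrite a0.
  by rewrite -a0; apply/ltW/a_homo.
have a_ltN (i : 'I_M) : a i < N%:Z.
  have le_last : a i <= a M.-1.
    have : (i <= M.-1)%N by rewrite -ltnS prednK.
    rewrite leq_eqVlt => /predU1P[->//|iM].
    by apply/ltW/a_homo => //; rewrite prednK.
  have := le_trans le_last a_le; lra.
(* All [a i] lie in $[0, N - 1]$; this is what makes them distinct modulo $N$ and the nodes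
   distinct. *)
have a_dist (i j : 'I_M) : `|a i - a j| < N%:Z.
  have := a_ge0 i; have := a_ge0 j; have := a_ltN i; have := a_ltN j.
  by move=> ? ? ? ?; rewrite ltr_norml; apply/andP; split; lra.
have [A1 [B1 [A10 B10 seq_bound]]] := exponential_riesz_sequence R N_gt0 a_inj a_dist.
have [A2 [B2 [A20 B20 frame_bound]]] := exponential_frame R N_gt0 a_inj a_dist.
(* [riesz_basis] asks for one pair of constants valid in both double inequalities. *)
exists (Num.min A1 A2), (Num.max B1 B2); split.
- by rewrite lt_min A10.
- by rewrite lt_max B10.
- move=> J c; have /andP[h1 h2] := seq_bound J c.
  have s0 : 0 <= \sum_(j <- J) Normc.normc (c j) ^+ 2.
    by apply: sumr_ge0 => p _; exact: sqr_ge0.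
  apply/andP; split.
    by apply: le_trans h1; rewrite ler_wpM2r // ge_min lexx.
  by apply: le_trans h2 _; rewrite ler_wpM2r // le_max lexx.
- move=> w; have /andP[h1 h2] := frame_bound w.
  have w0 : (0 <= (sqnorm (L2ip lebesgue_measure (measurable_unit_intervals R M a)) w)%:E)%E.
    by rewrite lee_fin sqnorm_ge0.
  apply/andP; split.
    by apply: le_trans h1; rewrite lee_wpmul2r // lee_fin ge_min lexx orbT.
  by apply: le_trans h2 _; rewrite lee_wpmul2r // lee_fin le_max lexx orbT.
Qed.
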